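(* Let $\Omega\subset\mathbb{X}$ be convex and compact, $\kappa$ a positive integer, and $\mathcal{F}=\{X\in\Omega:\mathrm{rank}(X)\le\kappa\}\ne\emptyset$. Suppose that the multifunction $\Gamma(\omega)=\{X\in\Omega:\sum_{i=\kappa+1}^n\sigma_i(X)=\omega\}$, $\omega\in\mathbb{R}$, is calm at $0$ for each $X\in\Gamma(0)$. Then there exists a constant $c>0$ such that for any $X\in\mathbb{X}$, $$\mathrm{dist}(X,\mathcal{F})\le(1+c\sqrt{n})\,\mathrm{dist}(X,\Omega)+c\sum_{i=\kappa+1}^n\sigma_i(X).$$ Moreover, the constant $c$ can be specified as follows: (i) $c=\sqrt{1+c_u^2/c_l^2}$ when $\mathcal{F}=\{X\in\mathbb{R}^{n_1\times n_2}:\mathrm{rank}(X)\le\kappa,\ |\!|\!|X|\!|\!|\le\gamma\}$ (with $\Omega=\{X\in\mathbb{R}^{n_1\times n_2}:|\!|\!|X|\!|\!|\le\gamma\}$), and in this case one may take $c=1$ if $|\!|\!|\cdot|\!|\!|$ is unitarily invariant; (ii) $c=\sqrt{2}$ when $\mathcal{F}=\{X\in\mathbb{H}^n_+:\mathrm{rank}(X)\le\kappa,\ \mathrm{tr}(X)=1\}$ (with $\Omega=\{X\in\mathbb{H}^n_+:\mathrm{tr}(X)=1\}$); (iii) $c=1+2n$ when $\mathcal{F}=\{X\in\mathbb{H}^n_+:\mathrm{rank}(X)\le\kappa,\ \mathrm{diag}(X)=e\}$ (with $\Omega=\{X\in\mathbb{H}^n_+:\mathrm{diag}(X)=e\}$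).
   Context: $\mathbb{X}$ denotes either $\mathbb{R}^{n_1\times n_2}$ (with $n=\min(n_1,n_2)$) or the space $\mathbb{H}^n$ of $n\times n$ Hermitian matrices, endowed with the trace inner product and its induced Frobenius norm $\|\cdot\|_F$; $\mathrm{dist}$ is the distance in $\|\cdot\|_F$. $\mathbb{H}^n_+$ is the cone of Hermitian positive semidefinite matrices. $\sigma_1(X)\ge\cdots\ge\sigma_n(X)\ge0$ are the singular values of $X$; empty sums are $0$. In (i), $|\!|\!|\cdot|\!|\!|$ is a norm on $\mathbb{R}^{n_1\times n_2}$, $\gamma>0$, and $c_l,c_u>0$ are constants with $c_l\|\cdot\|_F\le|\!|\!|\cdot|\!|\!|\le c_u\|\cdot\|_F$. In (iii), $e\in\mathbb{R}^n$ is the all-ones vector and $\mathrm{diag}(X)$ is the vector of diagonal entries of $X$. Calmness: a multifunction $\Upsilon:\mathbb{Y}\rightrightarrows\mathbb{Z}$ between finite dimensional normed spaces is calm at $\overline{y}$ for $\overline{z}\in\Upsilon(\overline{y})$ if there exist $\alpha\ge0$ and neighborhoods $\mathcal{U}$ of $\overline{y}$, $\mathcal{V}$ of $\overline{z}$ such that $\Upsilon(y)\cap\mathcal{V}\subseteq\Upsilon(\overline{y})+\alpha\|y-\overline{y}\|\mathbb{B}_{\mathbb{Z}}$ for all $y\in\mathcal{U}$, where $\mathbb{B}_{\mathbb{Z}}$ is the closed unit ball of $\mathbb{Z}$ centered at the origin. *)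

(* Defs.v *)
From HB Require Import structures.
From mathcomp Require Import all_boot all_order all_algebra.
From mathcomp Require Import all_classical all_reals all_analysis.
From mathcomp Require Import complex.
From mathcomp Require Import lra.

Set Implicit Arguments.
Unset Strict Implicit.
Unset Printing Implicit Defensive.

Import Order.TTheory GRing.Theory Num.Theory.
Import numFieldNormedType.Exports.

Local Open Scope classical_set_scope.
Local Open Scope complex_scope.
Local Open Scope ring_scope.
Local Open Scope sesquilinear_scope.

Definition is_inner (R : realType) (V : lmodType R) (d : V -> V -> R) : Prop :=
  [/\ forall x y, d x y = d y x,
      forall x y z, d (x + y) z = d x z + d y z,
      forall a x y, d (a *: x) y = a * d x y,
      forall x, 0 <= d x x
    & forall x, d x x = 0 -> x = 0].

Section InnerNorm.
Variables (R : realType) (V : lmodType R) (d : V -> V -> R).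
Hypothesis dP : is_inner d.

Let nrm x := Num.sqrt (d x x).

Lemma inner_cauchy_schwarz x y : d x y <= nrm x * nrm y.
Proof.
case: dP => dC dD dZ d_ge0 d_eq0.
have dZr a u v : d u (a *: v) = a * d u v by rewrite dC dZ dC.
have dDr u v w : d u (v + w) = d u v + d u w by rewrite dC dD !(dC u).
have [y0|y_neq0] := eqVneq (d y y) 0.
  rewrite (d_eq0 _ y0) -[X in d x X](scale0r (0 : V)) dZr mul0r.
  by rewrite mulr_ge0 ?sqrtr_ge0.
have dyy : 0 < d y y by rewrite lt_neqAle eq_sym y_neq0 d_ge0.
rewrite -sqrtrM ?d_ge0//.
apply: (le_trans (ler_norm _)); rewrite -sqrtr_sqr; apply: ler_wsqrtr.
have := d_ge0 (d y y *: x + (- d x y) *: y).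
rewrite !(dD, dDr, dZ, dZr) (dC y x).
set a := d x x; set b := d x y; set c := d y y => h.
have : 0 <= c * (a * c - b ^+ 2) by move: h; rewrite expr2; lra.
by rewrite pmulr_rge0// subr_ge0.
Qed.

Lemma inner_ler_normD x y : nrm (x + y) <= nrm x + nrm y.
Proof.
have := inner_cauchy_schwarz x y.
case: dP => dC dD dZ d_ge0 d_eq0 cs.
have nn : 0 <= nrm x + nrm y by rewrite addr_ge0 ?sqrtr_ge0.
rewrite -[leRHS]ger0_norm// -sqrtr_sqr; apply: ler_wsqrtr.
rewrite sqrrD !sqr_sqrtr// dD (dC _ (x + y)) (dC _ (x + y)) !dD (dC y x).
by move: cs; rewrite mulr2n; lra.
Qed.

Lemma inner_normrZ (a : R) x : nrm (a *: x) = `|a| * nrm x.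
Proof.
case: dP => dC dD dZ d_ge0 d_eq0.
by rewrite /nrm dZ dC dZ mulrA -expr2 sqrtrM ?sqr_ge0// sqrtr_sqr.
Qed.

Lemma inner_normr0_eq0 x : nrm x = 0 -> x = 0.
Proof.
case: dP => dC dD dZ d_ge0 d_eq0 /eqP.
rewrite sqrtr_eq0 => h; apply: d_eq0.
by apply/eqP; rewrite eq_le h d_ge0.
Qed.

End InnerNorm.

(* An alias is needed because the library norm on 'M[R]_(m, n) is the maximum
   of the absolute values of the entries. *)
Definition rectmx (R : realType) (m n : nat) : Type := 'M[R]_(m, n).

Section RectMx.
Variables (R : realType) (m n : nat).

HB.instance Definition _ := GRing.Lmodule.copy (rectmx R m n) 'M[R]_(m, n).

Definition rect_dot (A B : 'M[R]_(m, n)) : R := \tr (A^T *m B).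

Lemma rect_dotE (A B : 'M[R]_(m, n)) :
  rect_dot A B = \sum_(j < n) \sum_(i < m) A i j * B i j.
Proof.
apply: eq_bigr => j _; rewrite mxE; apply: eq_bigr => i _.
by rewrite mxE.
Qed.

Lemma rect_dotP : @is_inner R (rectmx R m n) rect_dot.
Proof.
split.
- move=> A B; rewrite !rect_dotE; apply: eq_bigr => j _.
  by apply: eq_bigr => i _; rewrite mulrC.
- by move=> A B C; rewrite /rect_dot linearD mulmxDl linearD.
- by move=> a A B; rewrite /rect_dot linearZ -scalemxAl linearZ.
- move=> A; rewrite rect_dotE sumr_ge0// => j _.
  by rewrite sumr_ge0// => i _; rewrite -expr2 sqr_ge0.
- move=> A; rewrite rect_dotE => /eqP.
  rewrite psumr_eq0; last first.
    by move=> j _; rewrite sumr_ge0// => i _; rewrite -expr2 sqr_ge0.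
  move=> /allP h; apply/matrixP => i j; rewrite mxE.
  have /(_ j) := h; rewrite mem_index_enum => /(_ isT)/=.
  rewrite psumr_eq0; last by move=> k _; rewrite -expr2 sqr_ge0.
  move=> /allP/(_ i); rewrite mem_index_enum => /(_ isT)/=.
  by rewrite -expr2 sqrf_eq0 => /eqP.
Qed.

HB.instance Definition _ := @Lmodule_isNormed.Build R (rectmx R m n)
  (fun A => Num.sqrt (rect_dot A A))
  (inner_ler_normD rect_dotP) (inner_normrZ rect_dotP)
  (inner_normr0_eq0 rect_dotP).

Lemma rect_normE (A : rectmx R m n) : `|A| = Num.sqrt (rect_dot A A).
Proof. by []. Qed.

End RectMx.

Record hermx (R : realType) (n : nat) : Type := Hermx {
  hermx_val :> 'M[R[i]]_n;
  hermxP : hermx_val \is hermsymmx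
}.

Section HermMx.
Variables (R : realType) (n : nat).

HB.instance Definition _ := [isSub for @hermx_val R n].
HB.instance Definition _ := [Choice of hermx R n by <:].

Lemma hermxE (A : 'M[R[i]]_n) : (A \is hermsymmx) = (A == A ^t*).
Proof. by rewrite is_hermitianmxE expr0 scale1r. Qed.

Fact hermx_zmod_closed : zmod_closed [pred A : 'M[R[i]]_n | A \is hermsymmx].
Proof.
split=> [|A B]; rewrite !inE !hermxE ?trmx0 ?map_mx0//.
move=> /eqP hA /eqP hB; rewrite linearB/= map_mxB/= -hA -hB.
by [].
Qed.

Fact herm0_subproof : (0 : 'M[R[i]]_n) \is hermsymmx.
Proof. by have [] := hermx_zmod_closed. Qed.

Fact hermN_subproof (A : hermx R n) : - (hermx_val A) \is hermsymmx.
Proof.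
have [h0 h] := hermx_zmod_closed.
by have := h 0 A h0 (hermxP A); rewrite sub0r.
Qed.

Fact hermD_subproof (A B : hermx R n) : (hermx_val A) + B \is hermsymmx.
Proof.
have [h0 h] := hermx_zmod_closed.
by have := h A (- (hermx_val B)) (hermxP A) (hermN_subproof B); rewrite opprK.
Qed.

Fact hermZ_subproof (a : R) (A : hermx R n) : a%:C *: (hermx_val A) \is hermsymmx.
Proof.
have := hermxP A; rewrite !hermxE => /eqP hA.
by rewrite linearZ/= map_mxZ/= -hA conj_Creal// complex_real.
Qed.

Definition herm0 := Hermx herm0_subproof.
Definition hermN A := Hermx (hermN_subproof A).
Definition hermD A B := Hermx (hermD_subproof A B).
Definition hermZ a A := Hermx (hermZ_subproof a A).

Fact hermDA : associative hermD.
Proof. by move=> A B C; apply: val_inj; rewrite /= addrA. Qed.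
Fact hermDC : commutative hermD.
Proof. by move=> A B; apply: val_inj; rewrite /= addrC. Qed.
Fact herm0D : left_id herm0 hermD.
Proof. by move=> A; apply: val_inj; rewrite /= add0r. Qed.
Fact hermND : left_inverse herm0 hermN hermD.
Proof. by move=> A; apply: val_inj; rewrite /= addNr. Qed.

HB.instance Definition _ :=
  GRing.isZmodule.Build (hermx R n) hermDA hermDC herm0D hermND.

Fact hermZA a b A : hermZ a (hermZ b A) = hermZ (a * b) A.
Proof. by apply: val_inj; rewrite /= scalerA rmorphM. Qed.
Fact herm1Z : left_id 1 hermZ.
Proof. by move=> A; apply: val_inj; rewrite /= scale1r. Qed.
Fact hermZDr : right_distributive hermZ +%R.
Proof. by move=> a A B; apply: val_inj; rewrite /= scalerDr. Qed.
Fact hermZDl A : {morph hermZ^~ A : a b / a + b}.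
Proof. by move=> a b; apply: val_inj; rewrite /= rmorphD scalerDl. Qed.

HB.instance Definition _ := GRing.Zmodule_isLmodule.Build R (hermx R n)
  hermZA herm1Z hermZDr hermZDl.

(* The trace is real when A and B are Hermitian. *)
Definition herm_dot (A B : 'M[R[i]]_n) : R := complex.Re (\tr (A ^t* *m B)).

Lemma herm_dotE (A B : 'M[R[i]]_n) : herm_dot A B =
  \sum_(j < n) \sum_(i < n)
    (complex.Re (A i j) * complex.Re (B i j) +
     complex.Im (A i j) * complex.Im (B i j)).
Proof.
have ReS I (r : seq I) (F : I -> R[i]) :
    complex.Re (\sum_(i <- r) F i) = \sum_(i <- r) complex.Re (F i).
  elim: r => [|i r IH]; rewrite ?big_nil// !big_cons -IH.
  by case: (F i) => ? ?; case: (\sum_(j <- r) _).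
rewrite /herm_dot /mxtrace ReS; apply: eq_bigr => j _.
rewrite mxE ReS; apply: eq_bigr => i _; rewrite !mxE.
by case: (A i j) => a b; case: (B i j) => c d /=; rewrite mulNr opprK.
Qed.

Lemma herm_dotP : @is_inner R (hermx R n) herm_dot.
Proof.
have pos (A : 'M[R[i]]_n) i j : 0 <= complex.Re (A i j) * complex.Re (A i j) +
    complex.Im (A i j) * complex.Im (A i j).
  by rewrite addr_ge0// -expr2 sqr_ge0.
split.
- move=> A B; rewrite !herm_dotE; apply: eq_bigr => j _.
  by apply: eq_bigr => i _; rewrite mulrC [X in _ + X]mulrC.
- move=> A B C; rewrite !herm_dotE -big_split; apply: eq_bigr => j _ /=.
  rewrite -big_split; apply: eq_bigr => i _ /=; rewrite !mxE.
  by case: (hermx_val A i j) => ? ?; case: (hermx_val B i j) => ? ? /=; lra.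
- move=> a A B; rewrite !herm_dotE mulr_sumr; apply: eq_bigr => j _ /=.
  rewrite mulr_sumr; apply: eq_bigr => i _ /=; rewrite !mxE.
  by case: (hermx_val A i j) => ? ? /=; lra.
- move=> A; rewrite herm_dotE sumr_ge0// => j _.
  by rewrite sumr_ge0// => i _; exact: pos.
- move=> A; rewrite herm_dotE => /eqP.
  rewrite psumr_eq0; last by move=> j _; rewrite sumr_ge0// => i _; exact: pos.
  move=> /allP h; apply/val_inj/matrixP => i j; rewrite [RHS]mxE.
  have /(_ j) := h; rewrite mem_index_enum => /(_ isT)/=.
  rewrite psumr_eq0; last by move=> k _; exact: pos.
  move=> /allP/(_ i); rewrite mem_index_enum => /(_ isT)/=.
  rewrite paddr_eq0 -?expr2 ?sqr_ge0// !sqrf_eq0.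
  by case: (hermx_val A i j) => a b /= /andP[/eqP -> /eqP ->].
Qed.

HB.instance Definition _ := @Lmodule_isNormed.Build R (hermx R n)
  (fun A => Num.sqrt (herm_dot A A))
  (inner_ler_normD herm_dotP) (inner_normrZ herm_dotP)
  (inner_normr0_eq0 herm_dotP).

Lemma herm_normE (A : hermx R n) : `|A| = Num.sqrt (herm_dot A A).
Proof. by []. Qed.

End HermMx.

Section SingularValues.
Variables (R : realType) (m n : nat).

(* The eigenvalues of A^* A are those of an n x n matrix; when m < n the last
   n - m of them, in decreasing order, are zero and are discarded. *)
Definition singular_values (A : 'M[R[i]]_(m, n)) : seq R :=
  take (minn m n)
    (sort (fun x y => y <= x)
      [seq Num.sqrt (complex.Re (spectral_diag (A ^t* *m A) 0 j))
         | j <- enum 'I_n]).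

(* Indexed from 1. *)
Definition sigma (A : 'M[R[i]]_(m, n)) (i : nat) : R :=
  (singular_values A)`_i.-1.

End SingularValues.

Inductive mspace : Type := Rect of nat & nat | Herm of nat.

Definition nrow (s : mspace) : nat :=
  match s with Rect n1 _ => n1 | Herm n => n end.
Definition ncol (s : mspace) : nat :=
  match s with Rect _ n2 => n2 | Herm n => n end.
Definition mdim (s : mspace) : nat := minn (nrow s) (ncol s).

Section MatrixSpace.
Variable R : realType.

Definition mspace_type (s : mspace) : normedModType R :=
  match s with Rect n1 n2 => rectmx R n1 n2 | Herm n => hermx R n end.

Definition to_cmx (s : mspace) : mspace_type s -> 'M[R[i]]_(nrow s, ncol s) :=
  match s return mspace_type s -> 'M[R[i]]_(nrow s, ncol s) with
  | Rect n1 n2 => fun X : 'M[R]_(n1, n2) => map_mx (real_complex R) X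
  | Herm n => fun X : hermx R n => hermx_val X
  end.

Definition mrank (s : mspace) : mspace_type s -> nat :=
  match s return mspace_type s -> nat with
  | Rect n1 n2 => fun X : 'M[R]_(n1, n2) => \rank X
  | Herm n => fun X : hermx R n => \rank (hermx_val X)
  end.

Definition sigma_tail (s : mspace) (kappa : nat) (X : mspace_type s) : R :=
  \sum_(kappa.+1 <= i < (mdim s).+1) sigma (to_cmx X) i.

Definition rank_constrained (s : mspace) (Omega : set (mspace_type s))
    (kappa : nat) : set (mspace_type s) :=
  [set X | Omega X /\ (mrank X <= kappa)%N].

Definition tail_level (s : mspace) (Omega : set (mspace_type s))
    (kappa : nat) (omega : R^o) : set (mspace_type s) :=
  [set X | Omega X /\ sigma_tail kappa X = omega].

End MatrixSpace.

Definition dist (R : realType) (V : normedModType R) (x : V) (A : set V) : R :=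
  inf [set `|x - a| | a in A].

Definition calm (R : realType) (Y Z : normedModType R) (G : Y -> set Z)
    (y0 : Y) (z0 : Z) : Prop :=
  exists (alpha : R) (U : set Y) (V : set Z),
    [/\ 0 <= alpha, nbhs y0 U, nbhs z0 V &
      forall y, U y -> G y `&` V `<=`
        [set z + (alpha * `|y - y0|) *: b
           | z in G y0 & b in [set b : Z | `|b| <= 1]]].

Definition error_bound (R : realType) (s : mspace)
    (Omega : set (mspace_type R s)) (kappa : nat) (c : R) : Prop :=
  forall X : mspace_type R s,
    dist X (rank_constrained Omega kappa) <=
      (1 + c * Num.sqrt (mdim s)%:R) * dist X Omega + c * sigma_tail kappa X.

Definition is_norm (R : numDomainType) (V : lmodType R) (N : V -> R) : Prop :=
  [/\ forall x y, N (x + y) <= N x + N y,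
      forall a x, N (a *: x) = `|a| * N x
    & forall x, N x = 0 -> x = 0].

Definition unitarily_invariant (R : realType) (m n : nat)
    (N : 'M[R]_(m, n) -> R) : Prop :=
  forall (U : 'M[R]_m) (V : 'M[R]_n),
    U *m U^T = 1%:M -> V *m V^T = 1%:M ->
    forall X : 'M[R]_(m, n), N (U *m X *m V) = N X.

(* In R[i], [0 <= z] means that z is real and nonnegative. *)
Definition possemidef (R : realType) (n : nat) (A : 'M[R[i]]_n) : Prop :=
  A \is hermsymmx /\ forall v : 'cV[R[i]]_n, 0 <= (v ^t* *m A *m v) 0 0.

(* Main.v *)
(* For a matrix A with singular values s and unitary matrix V of right singular
   vectors, let W be the partial isometry with W A = |A|. Ky Fan's principle
   gives, for any projector Q of corank k, tail_k(A) <= tr(W A Q), whereas for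
   Q the orthogonal of the top k right singular vectors of B one has
   |tr(W B Q)| <= tail_k(B). Since |W^* Q|_F^2 <= min(n1, n2), Cauchy-Schwarz
   yields tail_k(A) <= tail_k(B) + sqrt(min(n1, n2)) |A - B|_F (and, for A = B,
   that tail_k does not depend on the decomposition used to compute it). Hence
   an estimate dist(X, F) <= c tail_k(X) for X in Omega extends to all X.
   For X in Omega, the estimate follows
   - in general from calmness by compactness;
   - for a norm ball, by scaling back the truncated SVD X P, with P a real
     projector; if the norm is unitarily invariant, N (X P) <= N X;
   - for trace one, by moving the tail onto the top eigenvalue;
   - for unit diagonal, by rescaling the truncation to D^-1/2 X_k D^-1/2 when
     the tail is < 1, and with the all-ones matrix otherwise. *)

Require Import Defs.
From HB Require Import structures.
From mathcomp Require Import all_boot all_order all_algebra all_fingroup.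
From mathcomp Require Import all_classical all_reals all_analysis.
From mathcomp Require Import complex.
From mathcomp Require Import ring lra.

Import Order.TTheory GRing.Theory Num.Theory.
Import numFieldNormedType.Exports.

Local Open Scope classical_set_scope.
Local Open Scope ring_scope.

Set Implicit Arguments.
Unset Strict Implicit.
Unset Printing Implicit Defensive.

(** * Averages of a decreasing sequence under doubly stochastic weights *)

Section DoublyStochastic.
Variables (R : numDomainType) (n : nat).

(** Averaging step of Ky Fan's principle: the weights [q j] collected from the rows [i >= k] lie in
    [[0, 1]] and their total is the number of these rows, so the sum is least when the full weight
    sits on the smallest values of [s]. *)
Lemma doubly_stochastic_tail_ge (w : 'I_n -> 'I_n -> R) (s : 'I_n -> R)
    (k : nat) :
  (forall i j, 0 <= w i j) ->
  (forall i, \sum_j w i j = 1) -> (forall j, \sum_i w i j = 1) ->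
  (forall i j : 'I_n, (i <= j)%N -> s j <= s i) ->
  \sum_(i < n | (k <= i)%N) s i <=
    \sum_(i < n | (k <= i)%N) \sum_(j < n) s j * w i j.
Proof.
move=> w0 wr wc smono.
have [nk|kn] := leqP n k.
  by rewrite !big_pred0// => i; rewrite leqNgt (leq_trans (ltn_ord i) nk).
pose t := s (Ordinal kn).
pose q j := \sum_(i < n | (k <= i)%N) w i j.
have q0 j : 0 <= q j by apply: sumr_ge0.
have q1 j : q j <= 1.
  rewrite -(wc j) [leRHS](bigID (fun i : 'I_n => (k <= i)%N))/= lerDl.
  exact: sumr_ge0.
have sq : \sum_j q j = \sum_(i < n | (k <= i)%N) 1.
  by rewrite exchange_big/=; apply: eq_bigr.
rewrite [leRHS]exchange_big/=.
under [leRHS]eq_bigr do rewrite -mulr_sumr -/(q _).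
rewrite -subr_ge0.
(* Shifting [s] by the threshold [t] is free because [q] and the indicator of [k <= i] have the same
   sum. In each term the two factors are then both nonnegative or both nonpositive. *)
have -> : \sum_i s i * q i - \sum_(i < n | (k <= i)%N) s i =
    \sum_i (s i - t) * (q i - (k <= i)%N%:R).
  have kE (f : 'I_n -> R) :
      \sum_(i < n | (k <= i)%N) f i = \sum_i f i * (k <= i)%N%:R.
    rewrite big_mkcond; apply: eq_bigr => i _.
    by case: (k <= i)%N; rewrite ?mulr1 ?mulr0.
  under [RHS]eq_bigr do rewrite mulrBl !mulrBr.
  rewrite !sumrB -!mulr_sumr sq !kE.
  by under [X in t * X - _]eq_bigr do rewrite mul1r; rewrite subrr subr0.
apply: sumr_ge0 => i _; have [ki|ik] := leqP k i.
  by rewrite mulr_le0// subr_le0 ?q1//; apply: smono.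
by rewrite subr0 mulr_ge0// subr_ge0; apply: smono; exact: ltnW.
Qed.

End DoublyStochastic.

(** * Matrices diagonalized by a unitary matrix *)

Section UnitaryDiagonal.
Local Open Scope sesquilinear_scope.
Variable C : numClosedFieldType.

Lemma trmxC_mul (m n p : nat) (A : 'M[C]_(m, n)) (B : 'M[C]_(n, p)) :
  (A *m B)^t* = B^t* *m A^t*.
Proof. by rewrite trmx_mul map_mxM. Qed.

Lemma trmxCE (m n : nat) (A : 'M[C]_(m, n)) i j : A^t* i j = (A j i)^*.
Proof. by rewrite mxE; congr (_^*); exact: mxE. Qed.

Variable n : nat.
Implicit Types (V : 'M[C]_n) (a b : 'I_n -> C).

(** For unitary [V], the columns of [V^*] are eigenvectors with eigenvalues [a]. Taking [a] as a
    function lets matrix identities reduce to pointwise ones on the eigenvalues. *)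
Definition udiag V a : 'M[C]_n := V^t* *m diag_mx (\row_j a j) *m V.

Lemma udiagE V a i k : udiag V a i k = \sum_j a j * ((V j i)^* * V j k).
Proof.
rewrite /udiag mul_mx_diag mxE; apply: eq_bigr => j _.
by rewrite !mxE mulrA [a j * _]mulrC.
Qed.

Lemma eq_udiag V a b : a =1 b -> udiag V a = udiag V b.
Proof.
by move=> ab; congr (_ *m diag_mx _ *m _); apply/rowP=> j; rewrite !mxE ab.
Qed.

Lemma udiagM V a b : V \is unitarymx ->
  udiag V a *m udiag V b = udiag V (fun j => a j * b j).
Proof.
move=> Vu; rewrite /udiag !mulmxA mulmxtVK// -[X in X *m V]mulmxA mulmx_diag.
by congr (_ *m diag_mx _ *m _); apply/rowP => j; rewrite !mxE.
Qed.

Lemma udiagB V a b : udiag V a - udiag V b = udiag V (fun j => a j - b j).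
Proof.
apply/matrixP => i k; rewrite !udiagE mxE [X in _ + X]mxE !udiagE -sumrB.
by apply: eq_bigr => j _; rewrite mulrBl.
Qed.

Lemma udiag1 V : V \is unitarymx -> udiag V (fun=> 1) = 1%:M.
Proof.
move=> Vu; rewrite /udiag.
have -> : \row_(j < n) (1 : C) = const_mx 1 by apply/rowP=> j; rewrite !mxE.
rewrite diag_const_mx mulmx1 -[X in _ *m X]trmxCK; apply/unitarymxP.
by rewrite trmxC_unitary.
Qed.

Lemma udiag_adj V a : (forall j, a j \is Num.real) ->
  (udiag V a)^t* = udiag V a.
Proof.
move=> ar; apply/matrixP => i k; rewrite mxE mxE !udiagE rmorph_sum/=.
apply: eq_bigr => j _; rewrite !rmorphM/= conjCK (CrealP (ar j)).
by rewrite [X in _ * X]mulrC.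
Qed.

Lemma mxtrace_udiag V a : V \is unitarymx -> \tr (udiag V a) = \sum_j a j.
Proof.
move=> Vu; rewrite /udiag mxtrace_mulC mulmxA.
move/unitarymxP: Vu => ->; rewrite mul1mx mxtrace_diag.
by apply: eq_bigr => j _; rewrite mxE.
Qed.

(** The coordinate projector [pid_mx (minn k n)] can be inserted after the diagonal factor without
    changing it. *)
Lemma udiag_rank_le V a k : (forall j : 'I_n, (k <= j)%N -> a j = 0) ->
  (\rank (udiag V a) <= k)%N.
Proof.
move=> a0; have -> : udiag V a = V^t* *m diag_mx (\row_j a j) *m
    pid_mx (minn k n) *m V.
  congr (_ *m _); rewrite -[RHS]mulmxA; congr (_ *m _).
  rewrite mul_diag_mx; apply/matrixP => i j; rewrite !mxE.
  rewrite leq_min ltn_ord andbT (inj_eq val_inj).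
  have [->|_] := eqVneq i j; last by rewrite mulr0n mulr0.
  by have [kj|jk] := leqP k j; rewrite ?mulr1n ?mulr1// a0// mul0r.
rewrite (leq_trans (mxrankM_maxl _ _))// (leq_trans (mxrankM_maxr _ _))//.
by rewrite rank_pid_mx ?geq_minr// geq_minl.
Qed.

(** Multiplying by the inverses of the first [k + 1] eigenvalues gives a projector of rank [k + 1],
    and a product has at most the rank of its factors. *)
Lemma udiag_rank_gt V a (k : 'I_n) : V \is unitarymx ->
  (forall j : 'I_n, (j <= k)%N -> a j != 0) -> (k < \rank (udiag V a))%N.
Proof.
move=> Vu a0; pose b (j : 'I_n) := if (j <= k)%N then (a j)^-1 else 0.
apply: leq_trans (mxrankM_maxr (udiag V b) _); rewrite udiagM//.
have -> : udiag V (fun j => b j * a j) = V^t* *m pid_mx k.+1 *m V.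
  congr (_ *m _ *m _); apply/matrixP => i j; rewrite !mxE.
  rewrite (inj_eq val_inj) ltnS /b.
  have [->|_] := eqVneq i j; last by rewrite mulr0n.
  by case: leqP => jk; rewrite ?mulVf ?a0 ?mul0r ?mulr1n.
rewrite mxrankMfree ?row_free_unit ?unitarymx_unit//.
rewrite -mxrank_tr trmx_mul tr_pid_mx mxrankMfree ?rank_pid_mx//.
by rewrite row_free_unit unitmx_tr unitarymx_unit ?trmxC_unitary.
Qed.

(** Squared moduli of the entries of [V U^*]: for unitary [U] and [V] this is a unistochastic
    matrix, hence a doubly stochastic one. *)
Definition overlap (U V : 'M[C]_n) (i j : 'I_n) : C :=
  (V *m U^t*) i j * ((V *m U^t*) i j)^*.

Lemma overlap_ge0 U V i j : 0 <= overlap U V i j.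
Proof. exact: mul_conjC_ge0. Qed.

Lemma overlap_row U V : U \is unitarymx -> V \is unitarymx ->
  forall i, \sum_j overlap U V i j = 1.
Proof.
move=> Uu Vu i; have : V *m U^t* \is unitarymx.
  by rewrite mul_unitarymx ?trmxC_unitary.
move=> /unitarymxP/(congr1 (fun M : 'M[C]_n => M i i)).
rewrite [RHS]mxE eqxx mulr1n => <-; rewrite [RHS]mxE.
by apply: eq_bigr => j _; rewrite trmxCE.
Qed.

Lemma overlap_sym U V i j : overlap U V i j = overlap V U j i.
Proof.
rewrite /overlap; have -> : (V *m U^t*) i j = ((U *m V^t*) j i)^*.
  have -> : V *m U^t* = (U *m V^t*)^t* by rewrite trmxC_mul trmxCK.
  by rewrite trmxCE.
by rewrite conjCK mulrC.
Qed.

Lemma overlap_col U V : U \is unitarymx -> V \is unitarymx ->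
  forall j, \sum_i overlap U V i j = 1.
Proof.
by move=> Uu Vu j; under eq_bigr do rewrite overlap_sym; exact: overlap_row.
Qed.

Lemma conj_udiag U V a i :
  (V *m udiag U a *m V^t*) i i = \sum_j a j * overlap U V i j.
Proof.
have -> : V *m udiag U a *m V^t* =
    (V *m U^t*) *m diag_mx (\row_j a j) *m (V *m U^t*)^t*.
  by rewrite /udiag trmxC_mul trmxCK !mulmxA.
rewrite mul_mx_diag mxE; apply: eq_bigr => j _.
by rewrite mxE trmxCE [(\row_ _ _) _ _]mxE mulrAC mulrC.
Qed.

Lemma mxtrace_udiag_mul U V a b :
  \tr (udiag U a *m udiag V b) = \sum_i b i * \sum_j a j * overlap U V i j.
Proof.
rewrite {2}/udiag !mulmxA mxtrace_mulC !mulmxA.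
rewrite mul_mx_diag /mxtrace; apply: eq_bigr => i _.
by rewrite -conj_udiag mxE mulrC [(\row_ _ _) _ _]mxE /udiag !mulmxA.
Qed.

(** Reordering the eigenvalues amounts to permuting the rows of [V]. *)
Lemma udiag_sort V a (s : seq C) : V \is unitarymx ->
  perm_eq s [seq a j | j <- enum 'I_n] ->
  exists2 p : 'S_n, row_perm p V \is unitarymx &
    udiag (row_perm p V) (fun j => s`_j) = udiag V a.
Proof.
move=> Vu pe0; have pe : perm_eq s [tuple a j | j < n] by [].
have [p pE] := tuple_permP pe.
have sE (j : 'I_n) : s`_j = a (p j) by rewrite pE -tnth_nth !tnth_mktuple.
exists p.
  move/unitarymxP : Vu => VV; apply/unitarymxP/matrixP => i j.
  transitivity ((V *m V^t*) (p i) (p j));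
    last by rewrite VV !mxE (inj_eq perm_inj).
  by rewrite !mxE; apply: eq_bigr => k _; rewrite !mxE.
apply/matrixP => i k; rewrite !udiagE [RHS](reindex_perm p)/=.
by apply: eq_bigr => j _; rewrite !mxE sE.
Qed.

Lemma hermsymmx_udiag (A : 'M[C]_n) : A \is hermsymmx ->
  A = udiag (spectralmx A) (spectral_diag A 0).
Proof.
move=> /hermitian_normalmx /orthomx_spectralP {1}->.
rewrite invmx_unitary ?spectral_unitarymx//; congr (_ *m diag_mx _ *m _).
by apply/rowP => j; rewrite mxE.
Qed.

Lemma udiag_form_ge0 V a : (forall j, 0 <= a j) ->
  forall v : 'cV[C]_n, 0 <= (v^t* *m udiag V a *m v) 0 0.
Proof.
move=> a0 v.
have -> : v^t* *m udiag V a *m v =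
    (V *m v)^t* *m diag_mx (\row_j a j) *m (V *m v).
  by rewrite /udiag trmxC_mul !mulmxA.
set y := V *m v; rewrite mul_mx_diag mxE sumr_ge0// => j _.
by rewrite !mxE mulrAC mulr_ge0// mulrC mul_conjC_ge0.
Qed.

(** The vector is the [j]-th column of [V^*]. This transfers nonnegativity from the quadratic form
    to the eigenvalues. *)
Lemma udiag_form_coef V a j : V \is unitarymx ->
  exists v : 'cV[C]_n, (v^t* *m udiag V a *m v) 0 0 = a j.
Proof.
move=> /unitarymxP VV; pose d : 'cV[C]_n := delta_mx j 0.
exists (V^t* *m d); have -> : (V^t* *m d)^t* *m udiag V a *m (V^t* *m d) =
    d^t* *m (V *m V^t* *m diag_mx (\row_j a j) *m (V *m V^t*)) *m d.
  by rewrite /udiag trmxC_mul trmxCK !mulmxA.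
rewrite VV mul1mx mulmx1 -mulmxA -colE mxE (bigD1 j)//= big1 => [|i ij].
  by rewrite !mxE eqxx conjC1 mul1r addr0 mulr1n.
by rewrite !mxE (negPf ij) conjC0 mul0r.
Qed.

End UnitaryDiagonal.

(** * Singular value data and the Lipschitz estimate for tails *)

Section SingularData.
Local Open Scope sesquilinear_scope.
Variable C : numClosedFieldType.

Definition fdot (m n : nat) (A B : 'M[C]_(m, n)) : C := \tr (A^t* *m B).

Lemma fdotE (m n : nat) (A B : 'M[C]_(m, n)) :
  fdot A B = \sum_j \sum_i (A i j)^* * B i j.
Proof.
rewrite /fdot /mxtrace; apply: eq_bigr => j _; rewrite mxE.
by apply: eq_bigr => i _; rewrite trmxCE.
Qed.

Lemma fdot_col (m n : nat) (A B : 'M[C]_(m, n)) j :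
  fdot (col j A) (col j B) = (A^t* *m B) j j.
Proof.
by rewrite fdotE big_ord1 mxE; apply: eq_bigr => i _; rewrite trmxCE !mxE.
Qed.

(** Reduces to vectors by [mxvec]; the arguments are swapped because [dotmx] conjugates its second
    argument and [fdot] its first. *)
Lemma fdot_cauchy_schwarz (m n : nat) (A B : 'M[C]_(m, n)) :
  `|fdot A B| <= sqrtC (fdot A A) * sqrtC (fdot B B).
Proof.
have dotE (X Y : 'M[C]_(m, n)) : fdot X Y = dotmx (mxvec Y) (mxvec X).
  rewrite fdotE exchange_big/= dotmxE mxE pair_bigA/=.
  rewrite [RHS](reindex _ (curry_mxvec_bij m n)); apply: eq_bigr => -[i j] _ /=.
  by rewrite trmxCE !mxvecE mulrC.
rewrite !dotE [leRHS]mulrC.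
by have [] := CauchySchwarz_sqrt (@dotmx C _) (mxvec B) (mxvec A).
Qed.

Lemma fdot_ge0 (m n : nat) (A : 'M[C]_(m, n)) : 0 <= fdot A A.
Proof.
rewrite fdotE; do 2 (apply: sumr_ge0 => ? _).
by rewrite mulrC mul_conjC_ge0.
Qed.

Lemma fdot_udiag (n : nat) (V : 'M[C]_n) a : V \is unitarymx ->
  (forall j, a j \is Num.real) ->
  fdot (udiag V a) (udiag V a) = \sum_j a j ^+ 2.
Proof. by move=> Vu ar; rewrite /fdot udiag_adj// udiagM// mxtrace_udiag. Qed.

(** A singular value decomposition seen through the Gram matrix, without left singular vectors.
    There are [n] values whatever [m] is; those beyond the rank are zero. *)
Definition sv_data (m n : nat) (A : 'M[C]_(m, n)) (V : 'M[C]_n)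
    (s : 'I_n -> C) : Prop :=
  [/\ V \is unitarymx, A^t* *m A = udiag V (fun j => s j ^+ 2),
      forall j, 0 <= s j & forall i j : 'I_n, (i <= j)%N -> s j <= s i].

(** Indices start at 0 here, so [k <= j] corresponds to [k + 1] and beyond in the one-based
    numbering of [sigma]. *)
Definition tail (n k : nat) (s : 'I_n -> C) : C :=
  \sum_(j < n | (k <= j)%N) s j.

(** If [s j] were nonzero, so would be all earlier values, and the Gram matrix, hence [A], would
    have rank greater than [j]. *)
Lemma sv_data_rank (m n : nat) (A : 'M[C]_(m, n)) V s (j : 'I_n) :
  sv_data A V s -> (\rank A <= j)%N -> s j = 0.
Proof.
case=> Vu AA s0 smono; apply: contraTeq => sj; rewrite -ltnNge.
rewrite (leq_trans _ (mxrankM_maxr (A^t*) A))// AA udiag_rank_gt// => i ij.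
rewrite expf_eq0/=.
have : 0 < s i by rewrite (lt_le_trans _ (smono _ _ ij))// lt_def sj s0.
by move/gt_eqF => ->.
Qed.

(** This count is the source of the factor [minn m n], instead of [n], in the Lipschitz constant. *)
Lemma sv_data_card (m n : nat) (A : 'M[C]_(m, n)) V s : sv_data A V s ->
  \sum_j (s j != 0)%:R <= (minn m n)%:R :> C.
Proof.
move=> As; apply: (@le_trans _ _ (\sum_(j < n) ((j < minn m n)%N)%:R)).
  apply: ler_sum => j _; rewrite ler_nat; case: ltnP => [_|mj].
    by case: (s j != 0).
  rewrite (sv_data_rank As) ?eqxx// (leq_trans _ mj)// leq_min.
  by rewrite rank_leq_row rank_leq_col.
rewrite -natr_sum ler_nat.
rewrite (eq_bigr (fun j : 'I_n => if (j < minn m n)%N then 1%N else 0%N)).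
  by rewrite -big_mkcond -(big_ord_widen _ (fun=> 1%N)) ?geq_minr//
    sum1_card card_ord.
by move=> j _; case: ltnP.
Qed.

(* With X = U' diag(s) U the matrix W below is a partial isometry such that
   W X = |X|, and Q projects onto the orthogonal of the top k right singular
   vectors of Y: the trace of W X Q dominates the tail of X by Ky Fan's
   principle, while that of W Y Q is dominated by the tail of Y. *)
Lemma tail_lipschitz (m n : nat) (X Y : 'M[C]_(m, n)) U V s t k :
  sv_data X U s -> sv_data Y V t ->
  tail k s <=
    tail k t + sqrtC (minn m n)%:R * sqrtC (fdot (X - Y) (X - Y)).
Proof.
move=> Xs; have := sv_data_card Xs; case: (Xs) => Uu XX s0 smono scard.
case=> Vu YY t0 tmono.
have sr j : (s j)^-1 \is Num.real by rewrite ger0_real// invr_ge0.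
(* Since the inverse of 0 is 0, the inverses act as a pseudo-inverse and vanishing singular values
   contribute nothing to [W]. *)
pose W := udiag U (fun j => (s j)^-1) *m X^t*.
pose e (j : 'I_n) : C := (s j != 0)%:R.
pose f (j : 'I_n) : C := (k <= j)%N%:R.
pose Q := udiag V f.
have Qadj : Q^t* = Q by apply: udiag_adj => j; rewrite realn.
have WX : W *m X = udiag U s.
  rewrite /W -mulmxA XX udiagM//; apply: eq_udiag => j.
  have [->|sj] := eqVneq (s j) 0; first by rewrite expr2 !mulr0.
  by rewrite expr2 mulKf.
have WW : W *m W^t* = udiag U e.
  rewrite {2}/W trmxC_mul trmxCK udiag_adj// mulmxA WX udiagM//.
  apply: eq_udiag => j; rewrite /e.
  by have [->|sj] := eqVneq (s j) 0; rewrite ?mul0r ?mulfV.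
have QQ : Q *m Q = Q.
  rewrite /Q udiagM//; apply: eq_udiag => j; rewrite /f.
  by case: (k <= j)%N; rewrite ?mulr0 ?mulr1.
have fsum (g : 'I_n -> C) : \sum_j f j * g j = \sum_(j < n | (k <= j)%N) g j.
  rewrite [RHS]big_mkcond; apply: eq_bigr => j _; rewrite /f.
  by case: (k <= j)%N; rewrite ?mul0r ?mul1r.
have lower : tail k s <= \tr (W *m X *m Q).
  rewrite WX mxtrace_udiag_mul fsum; apply: doubly_stochastic_tail_ge => //.
  - by move=> i j; exact: overlap_ge0.
  - exact: overlap_row.
  - exact: overlap_col.
(* Expand the trace along the right singular vectors [v_i] of [Y] with [i >= k]. Cauchy-Schwarz
   bounds each term by the norm of [W^* v_i], at most 1, times that of [Y v_i], which is [t i]. *)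
have upper : `|\tr (W *m Y *m Q)| <= tail k t.
  have -> : \tr (W *m Y *m Q) =
      \sum_i f i * ((W^t* *m V^t*)^t* *m (Y *m V^t*)) i i.
    rewrite /Q /udiag !mulmxA mxtrace_mulC !mulmxA mul_mx_diag /mxtrace.
    apply: eq_bigr => i _.
    by rewrite trmxC_mul !trmxCK !mulmxA mxE mulrC [(\row__ _) _ _]mxE.
  rewrite fsum; apply: (le_trans (ler_norm_sum _ _ _)).
  apply: ler_sum => i _; rewrite -fdot_col.
  apply: (le_trans (fdot_cauchy_schwarz _ _)).
  have DD : (W^t* *m V^t*)^t* = V *m W by rewrite trmxC_mul !trmxCK.
  have BB : (Y *m V^t*)^t* = V *m Y^t* by rewrite trmxC_mul trmxCK.
  rewrite !fdot_col DD BB.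
  have -> : V *m Y^t* *m (Y *m V^t*) = V *m udiag V (fun j => t j ^+ 2) *m V^t*.
    by rewrite -YY !mulmxA.
  have -> : V *m W *m (W^t* *m V^t*) = V *m udiag U e *m V^t*.
    by rewrite -WW !mulmxA.
  have -> : (V *m udiag V (fun j => t j ^+ 2) *m V^t*) i i = t i ^+ 2.
    rewrite /udiag !mulmxA; move/unitarymxP : (Vu) => ->.
    by rewrite mul1mx mulmxtVK// !mxE eqxx mulr1n.
  rewrite sqrCK// -[leRHS]mul1r ler_wpM2r// -[leRHS]sqrtC1.
  rewrite conj_udiag ler_sqrtC ?qualifE/= ?ler01//.
    rewrite -(overlap_row Uu Vu i); apply: ler_sum => j _.
    by rewrite ler_piMl ?overlap_ge0// /e; case: (s j != 0); rewrite ?ler01.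
  by apply: sumr_ge0 => j _; rewrite mulr_ge0 ?overlap_ge0 ?ler0n.
(* The squared norm of [W^* Q] is the trace of the projector [W W^*] compressed by [Q], hence at
   most the number of nonzero values of [s]. *)
have lip : `|\tr (W *m (X - Y) *m Q)| <=
    sqrtC (minn m n)%:R * sqrtC (fdot (X - Y) (X - Y)).
  have -> : \tr (W *m (X - Y) *m Q) = fdot (W^t* *m Q) (X - Y).
    by rewrite mxtrace_mulC mulmxA /fdot trmxC_mul trmxCK Qadj.
  apply: (le_trans (fdot_cauchy_schwarz _ _)).
  rewrite ler_wpM2r ?sqrtC_ge0 ?fdot_ge0//.
  rewrite ler_sqrtC ?qualifE/= ?fdot_ge0 ?ler0n// (le_trans _ scard)//.
  rewrite /fdot trmxC_mul trmxCK Qadj.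
  have -> : Q *m W *m (W^t* *m Q) = Q *m (W *m W^t* *m Q) by rewrite !mulmxA.
  rewrite WW mxtrace_mulC -mulmxA QQ mxtrace_udiag_mul fsum.
  rewrite [leRHS](_ : _ = \sum_i \sum_j e j * overlap U V i j); last first.
    rewrite exchange_big; apply: eq_bigr => j _/=.
    by rewrite -mulr_sumr overlap_col// mulr1.
  rewrite [leRHS](bigID (fun i : 'I_n => (k <= i)%N))/= lerDl.
  apply: sumr_ge0 => i _; apply: sumr_ge0 => j _.
  by rewrite mulr_ge0 ?overlap_ge0// ler0n.
have tail0 : 0 <= tail k s by apply: sumr_ge0.
have := lerD upper lip; apply: le_trans.
rewrite (le_trans _ (ler_normD _ _))//
  -mxtraceD -mulmxDl -mulmxDr [Y + _]addrC subrK.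
by rewrite (le_trans lower)// real_ler_norm// ger0_real// (le_trans tail0).
Qed.

(** The Lipschitz estimate between [X] and itself, used in both directions. *)
Lemma tail_unique (m n : nat) (X : 'M[C]_(m, n)) U V s t k :
  sv_data X U s -> sv_data X V t -> tail k s = tail k t.
Proof.
move=> Xs Xt; have := tail_lipschitz k Xs Xt; have := tail_lipschitz k Xt Xs.
rewrite subrr /fdot mulmx0 mxtrace0 sqrtC0 mulr0 !addr0 => ts st.
by apply/eqP; rewrite eq_le st ts.
Qed.

End SingularData.

(** * Spectral truncations and their errors *)

Section SpectralApproximation.
Local Open Scope sesquilinear_scope.
Variable C : numClosedFieldType.

Lemma sv_data_udiag (n : nat) (V : 'M[C]_n) s : V \is unitarymx ->
  (forall j, 0 <= s j) -> (forall i j : 'I_n, (i <= j)%N -> s j <= s i) ->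
  sv_data (udiag V s) V s.
Proof.
move=> Vu s0 smono; split=> //; rewrite udiag_adj ?udiagM// => j.
exact: ger0_real.
Qed.

Lemma sort_real_sorted (l : seq C) : {in l, forall x, x \is Num.real} ->
  sorted >=%R (sort >=%R l).
Proof.
move=> lr; apply: sort_sorted_in (allss l).
by move=> x y /lr xr /lr yr; rewrite real_leVge.
Qed.

Lemma sorted_ge_nth (l : seq C) : sorted >=%R l ->
  forall i j, (i <= j < size l)%N -> l`_j <= l`_i.
Proof.
move=> ls i j /andP[ij jl].
apply: (sorted_leq_nth (fun _ _ _ xy yz => le_trans yz xy) (@lexx _ C) 0 ls) =>
  //.
by rewrite inE (leq_ltn_trans ij).
Qed.

(** Evaluating the form at eigenvectors shows that the spectrum is nonnegative; sorting it then
    gives a decreasing [s]. *)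
Lemma psd_udiag (n : nat) (A : 'M[C]_n) : A \is hermsymmx ->
  (forall v : 'cV[C]_n, 0 <= (v^t* *m A *m v) 0 0) ->
  exists V s, [/\ V \is unitarymx, A = udiag V s, forall j, 0 <= s j
    & forall i j : 'I_n, (i <= j)%N -> s j <= s i].
Proof.
move=> Ah Apos; have Vu := spectral_unitarymx A.
pose d := spectral_diag A 0.
have AE : A = udiag (spectralmx A) d := hermsymmx_udiag Ah.
have d0 j : 0 <= d j.
  by have [v <-] := udiag_form_coef d j Vu; rewrite -AE.
pose l := [seq d j | j <- enum 'I_n].
have lE x : x \in l -> 0 <= x by move=> /mapP[j _ ->].
have pe : perm_eq (sort >=%R l) l by rewrite perm_sort.
have [p pu pE] := udiag_sort Vu pe.
exists (row_perm p (spectralmx A)), (fun j => (sort >=%R l)`_j); split=> //.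
- by rewrite pE.
- move=> j; apply: lE; rewrite -(mem_sort >=%R) mem_nth//.
  by rewrite size_sort size_map size_enum_ord.
- move=> i j ij; apply: sorted_ge_nth; last first.
    by rewrite ij size_sort size_map size_enum_ord ltn_ord.
  by apply: sort_real_sorted => x /lE x0; exact: ger0_real x0.
Qed.

Lemma sumr_sqr_le (I : Type) (r : seq I) (P : pred I) (a : I -> C) :
  (forall j, 0 <= a j) ->
  \sum_(j <- r | P j) a j ^+ 2 <= (\sum_(j <- r | P j) a j) ^+ 2.
Proof.
move=> a0; elim: r => [|j r IH]; first by rewrite !big_nil expr2 mulr0.
rewrite !big_cons; case: ifP => // _.
rewrite sqrrD -addrA lerD2l (le_trans IH)// lerDr mulrn_wge0// mulr_ge0//.
by apply: sumr_ge0.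
Qed.

(** For nonnegative eigenvalues, the sum of squares is at most the square of the sum. *)
Lemma psd_fdot_le (n : nat) (A : 'M[C]_n) : A \is hermsymmx ->
  (forall v : 'cV[C]_n, 0 <= (v^t* *m A *m v) 0 0) ->
  fdot A A <= (\tr A) ^+ 2.
Proof.
move=> Ah Apos; have [V [s [Vu -> s0 _]]] := psd_udiag Ah Apos.
rewrite fdot_udiag// => [|j]; last exact: ger0_real.
by rewrite mxtrace_udiag//; apply: sumr_sqr_le.
Qed.

Definition head_ind (n k : nat) (j : 'I_n) : C := (j < k)%N%:R.

(** The residual is [A Q] for the complementary projector [Q], so its squared norm is the sum of the
    squares of the discarded singular values. *)
Lemma fdot_truncation (m n k : nat) (A : 'M[C]_(m, n)) V s : sv_data A V s ->
  let B := A - A *m udiag V (@head_ind n k) in fdot B B <= (tail k s) ^+ 2.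
Proof.
case=> Vu AA s0 _ /=.
set P := udiag V _; pose Q := udiag V (fun j => 1 - @head_ind n k j).
have -> : A - A *m P = A *m Q.
  by rewrite /Q -udiagB udiag1// mulmxBr mulmx1.
have Qadj : Q^t* = Q.
  by apply: udiag_adj => j; rewrite realB ?real1 ?realn.
rewrite /fdot trmxC_mul Qadj -mulmxA [A^t* *m _]mulmxA AA !udiagM//.
rewrite mxtrace_udiag//.
rewrite [leLHS](_ : _ = \sum_(j < n | (k <= j)%N) s j ^+ 2);
  first exact: sumr_sqr_le.
rewrite [RHS]big_mkcond; apply: eq_bigr => j _; rewrite /head_ind.
by case: leqP => _; rewrite ?subr0 ?subrr ?mul0r ?mul1r ?mulr1.
Qed.

Lemma tail_ge0 (n k : nat) (s : 'I_n -> C) : (forall j, 0 <= s j) ->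
  0 <= tail k s.
Proof. by move=> s0; apply: sumr_ge0. Qed.

(** The tail mass [t] is moved to index 0, which is kept because [0 < k]. Erasing the tail and
    adding [t] each cost at most [t ^+ 2], whence the factor 2. *)
Lemma simplex_truncation (n k : nat) (s : 'I_n -> C) : (0 < k)%N -> (0 < n)%N ->
  (forall j, 0 <= s j) ->
  exists b : 'I_n -> C, [/\ forall j, 0 <= b j,
    forall j : 'I_n, (k <= j)%N -> b j = 0, \sum_j b j = \sum_j s j
    & \sum_j (s j - b j) ^+ 2 <= 2 * tail k s ^+ 2].
Proof.
case: n s => // n s k0 _ s0; set t := tail k s.
have t0 : 0 <= t by exact: tail_ge0.
exists (fun j : 'I_n.+1 => (if (j < k)%N then s j else 0) + (if j == ord0 then
  t else 0)).
split=> [j|j kj||].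
- by rewrite addr_ge0//; case: ifP.
- rewrite ltnNge kj/= add0r; case: eqP => // j0; move: kj; rewrite j0.
  by rewrite leqNgt k0.
- rewrite big_split/= -!big_mkcond/= big_pred1_eq.
  rewrite [RHS](bigID (fun j : 'I_n.+1 => (j < k)%N))/=; congr (_ + _).
  by apply: eq_bigl => j; rewrite leqNgt.
- rewrite [leLHS](_ : _ = \sum_(j < n.+1) ((if (k <= j)%N then s j ^+ 2 else 0)
      + (if j == ord0 then t ^+ 2 else 0))); last first.
    apply: eq_bigr => j _; case: (ltnP j k) => jk.
      by rewrite opprD addrA subrr sub0r sqrrN add0r; case: eqP => //;
        rewrite expr2 mulr0.
    rewrite add0r; case: eqP => [j0|_]; last by rewrite subr0 addr0.
    by move: jk; rewrite j0 leqNgt k0.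
  rewrite big_split/= -!big_mkcond/= big_pred1_eq mulr_natl mulr2n lerD2r.
  exact: sumr_sqr_le.
Qed.

End SpectralApproximation.

(** * Rank reduction among positive semidefinite matrices with unit diagonal *)

Section Elliptope.
Local Open Scope sesquilinear_scope.
Variables (C : numClosedFieldType) (n : nat).

Lemma congruence_psd (A D : 'M[C]_n) : A \is hermsymmx ->
  (forall v : 'cV[C]_n, 0 <= (v^t* *m A *m v) 0 0) ->
  D^t* *m A *m D \is hermsymmx /\
  forall v : 'cV[C]_n, 0 <= (v^t* *m (D^t* *m A *m D) *m v) 0 0.
Proof.
move=> /is_hermitianmxP; rewrite expr0 scale1r => Ah Apos; split.
  apply/is_hermitianmxP; rewrite expr0 scale1r.
  by rewrite !trmxC_mul trmxCK -Ah mulmxA.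
by move=> v; have := Apos (D *m v); rewrite trmxC_mul !mulmxA.
Qed.

Lemma const_mx1_outer : (const_mx 1 : 'M[C]_n) =
  (const_mx 1 : 'cV[C]_n) *m (const_mx 1 : 'rV[C]_n).
Proof. by apply/matrixP => i j; rewrite !mxE big_ord1 !mxE mulr1. Qed.

Lemma const_mx1_rank_le (k : nat) : (0 < k)%N ->
  (\rank (const_mx 1%R : 'M[C]_n) <= k)%N.
Proof.
move=> k0; rewrite const_mx1_outer (leq_trans (mxrankM_maxl _ _))//.
exact: leq_trans (rank_leq_col _) k0.
Qed.

Lemma const_mx1_psd : (const_mx 1 : 'M[C]_n) \is hermsymmx /\
  forall v : 'cV[C]_n, 0 <= (v^t* *m const_mx 1 *m v) 0 0.
Proof.
split.
  apply/is_hermitianmxP; rewrite expr0 scale1r.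
  by apply/matrixP => i j; rewrite trmxCE !mxE conjC1.
move=> v; rewrite const_mx1_outer mulmxA -mulmxA mxE big_ord1.
have -> : (v^t* *m (const_mx 1 : 'cV[C]_n)) 0 0 =
    (((const_mx 1 : 'rV[C]_n) *m v) 0 0)^*.
  rewrite !mxE rmorph_sum; apply: eq_bigr => i _.
  by rewrite trmxCE !mxE mul1r mulr1.
by rewrite mulrC mul_conjC_ge0.
Qed.

(** The error is split at an intermediate matrix [Z] so that the two bounds, with factors [1 + n]
    and [n], add up to [1 + 2 n]. *)
Lemma elliptope_truncation (k : nat) (V : 'M[C]_n) s : (0 < k)%N ->
  V \is unitarymx -> (forall j, 0 <= s j) ->
  (forall i, (udiag V s) i i = 1) ->
  exists Z Y : 'M[C]_n,
    [/\ Z \is hermsymmx,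
        Y \is hermsymmx /\ (forall v : 'cV[C]_n, 0 <= (v^t* *m Y *m v) 0 0),
        (\rank Y <= k)%N /\ (forall i, Y i i = 1),
        fdot (udiag V s - Z) (udiag V s - Z) <= ((1 + n%:R) * tail k s) ^+ 2
      & fdot (Z - Y) (Z - Y) <= (n%:R * tail k s) ^+ 2].
Proof.
move=> k0 Vu s0 diag1; set X := udiag V s; set t := tail k s.
have t0 : 0 <= t by exact: tail_ge0.
have sr j : s j \is Num.real by exact: ger0_real.
have Xpos := udiag_form_ge0 V s0.
have hermP (A : 'M[C]_n) : A^t* = A -> A \is hermsymmx.
  by move=> AA; apply/is_hermitianmxP; rewrite expr0 scale1r.
have tr1 (A : 'M[C]_n) : (forall i, A i i = 1) -> \tr A = n%:R.
  by move=> A1; rewrite /mxtrace (eq_bigr (fun=> 1)) ?sumr_const ?card_ord.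
have [t1|t1] := real_ltP (ger0_real t0) (@real1 C); last first.
  (* For [1 <= t] crude bounds suffice: a positive semidefinite matrix with unit diagonal has
     Frobenius norm at most its trace [n]. *)
  have [Yh Ypos] := const_mx1_psd.
  exists 0, (const_mx 1); split=> //.
  - by apply: hermP; rewrite trmx0 map_mx0.
  - by split; [exact: const_mx1_rank_le | move=> i; rewrite mxE].
  - rewrite subr0 (le_trans (psd_fdot_le _ Xpos)) ?hermP ?udiag_adj//.
    rewrite tr1// lerXn2r ?qualifE/= ?ler0n ?mulr_ge0 ?addr_ge0 ?ler01 ?ler0n//.
    by rewrite (le_trans (_ : _ <= 1 + n%:R)) ?lerDr ?ler01// ler_peMr//
      addr_ge0 ?ler01 ?ler0n.
  - have -> : fdot (0 - const_mx 1 : 'M[C]_n) (0 - const_mx 1) =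
        fdot (const_mx 1 : 'M[C]_n) (const_mx 1).
      rewrite !fdotE; do 2 (apply: eq_bigr => ? _).
      by rewrite !mxE sub0r rmorphN mulrNN.
    rewrite (le_trans (psd_fdot_le Yh Ypos))// tr1; last by move=> i;
      rewrite mxE.
    by rewrite lerXn2r ?qualifE/= ?ler0n ?mulr_ge0 ?ler0n// ler_peMr ?ler0n.
pose b j := s j * head_ind C k j.
have b0 j : 0 <= b j by rewrite mulr_ge0 ?ler0n.
pose Z := udiag V b; pose d i := Z i i.
have dE i : 1 - d i = \sum_(j < n | (k <= j)%N) s j * ((V j i)^* * V j i).
  have -> : 1 - d i = (X - Z) i i by rewrite [RHS]mxE diag1 [(- Z) i i]mxE.
  rewrite udiagB udiagE [RHS]big_mkcond; apply: eq_bigr => j _.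
  rewrite /b /head_ind; case: leqP => _; first by rewrite mulr0 subr0.
  by rewrite mulr1 subrr mul0r.
have d1 i : d i <= 1.
  rewrite -subr_ge0 dE; apply: sumr_ge0 => j _.
  by rewrite mulr_ge0// mulrC mul_conjC_ge0.
have V1 i j : (V j i)^* * V j i <= 1.
  have : (V^t* *m V) i i = 1.
    have -> : V^t* *m V = 1%:M.
      rewrite -[X in _ *m X]trmxCK; apply/unitarymxP.
      by rewrite trmxC_unitary.
    by rewrite mxE eqxx.
  rewrite mxE (bigD1 j)//= trmxCE => <-; rewrite lerDl; apply: sumr_ge0 => l _.
  by rewrite trmxCE mulrC mul_conjC_ge0.
(* The entries of [V] have modulus at most 1, so truncation lowers each diagonal entry by at most
   [t]. As [t < 1], the diagonal of [Z] stays positive and can be normalized. *)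
have dt i : 1 - t <= d i.
  rewrite lerBlDl -lerBlDr dE; apply: ler_sum => j _.
  by rewrite -[leRHS]mulr1 ler_wpM2l.
have dpos i : 0 < d i by rewrite (lt_le_trans _ (dt i))// subr_gt0.
pose q i := sqrtC (d i).
have q0 i : 0 < q i by rewrite sqrtC_gt0.
have q1 i : q i <= 1.
  by rewrite -[leRHS]sqrtC1 ler_sqrtC ?qualifE/= ?ler01 ?(ltW (dpos _)).
have qq i : q i * q i = d i by rewrite -expr2 sqrtCK.
pose D : 'M[C]_n := diag_mx (\row_i (q i)^-1).
have Dadj : D^t* = D.
  apply/matrixP => i j; rewrite trmxCE !mxE.
  have [->|ij] := eqVneq i j.
    by rewrite !mulr1n; apply/CrealP/ger0_real; rewrite invr_ge0 ltW.
  by rewrite mulr0n conjC0.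
pose Y := D^t* *m Z *m D.
have YE i j : Y i j = (q i)^-1 * Z i j * (q j)^-1.
  by rewrite /Y Dadj mul_mx_diag mxE mul_diag_mx !mxE.
have [Yh Ypos] : Y \is hermsymmx /\ forall v : 'cV[C]_n,
  0 <= (v^t* *m Y *m v) 0 0.
  apply: congruence_psd; last exact: udiag_form_ge0.
  by apply/hermP/udiag_adj => j; exact: ger0_real.
have Y1 i : Y i i = 1.
  rewrite YE -/(d i) -qq mulrA mulVf ?mul1r ?mulfV//; exact: lt0r_neq0.
exists Z, Y; split=> //.
- by apply/hermP/udiag_adj => j; exact: ger0_real.
- split=> //; rewrite (leq_trans (mxrankM_maxl _ _))//.
  rewrite (leq_trans (mxrankM_maxr _ _))// udiag_rank_le// => j kj.
  by rewrite /b /head_ind ltnNge kj mulr0.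
- rewrite udiagB fdot_udiag// => [|j]; last by rewrite realB// ger0_real.
  rewrite (@le_trans _ _ (t ^+ 2))//.
    rewrite [leLHS](_ : _ = \sum_(j < n | (k <= j)%N) s j ^+ 2);
      first exact: sumr_sqr_le.
    rewrite [RHS]big_mkcond; apply: eq_bigr => j _; rewrite /b /head_ind.
    by case: leqP => _; rewrite ?mulr0 ?subr0// mulr1 subrr expr2 mulr0.
  rewrite lerXn2r ?qualifE/= ?mulr_ge0 ?addr_ge0 ?ler01 ?ler0n//.
  by rewrite ler_peMl// lerDl ler0n.
(* Entrywise [Z - Y] is [(q i * q j - 1) * Y i j]. As every [q] lies between [sqrtC (1 - t)] and 1,
   the factor has modulus at most [t], while the norm of [Y] is at most its trace [n]. *)
- have : t ^+ 2 * fdot Y Y <= (n%:R * t) ^+ 2.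
    rewrite exprMn mulrC ler_wpM2r ?exprn_ge0// -(tr1 Y Y1).
    exact: psd_fdot_le.
  apply: le_trans; rewrite !fdotE mulr_sumr; apply: ler_sum => j _.
  rewrite mulr_sumr; apply: ler_sum => i _.
  have -> : (Z - Y) i j = (q i * q j - 1) * Y i j.
    rewrite mxE [(- Y) i j]mxE mulrBl mul1r; congr (_ - _).
    rewrite YE; field; rewrite !lt0r_neq0//.
  have qr : q i * q j - 1 \is Num.real.
    by rewrite realB ?real1// realM// ger0_real// ltW.
  rewrite rmorphM/= (CrealP qr) mulrACA -expr2.
  rewrite ler_wpM2r//; first by rewrite mulrC mul_conjC_ge0.
  rewrite -sqrrN opprB lerXn2r ?qualifE//=.
    by rewrite subr_ge0 -[leRHS]mulr1 ler_pM// ltW.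
  rewrite lerBlDl -lerBlDr.
  have u0 : 0 <= 1 - t by rewrite subr_ge0 ltW.
  have uq l : sqrtC (1 - t) <= q l.
    by rewrite ler_sqrtC ?qualifE/= ?(ltW (dpos _)).
  rewrite -[leLHS](sqrtCK (1 - t)) expr2 ler_pM ?sqrtC_ge0//.
Qed.

End Elliptope.

(** * Gram matrices and the rank read off the tail *)

Section Gram.
Local Open Scope sesquilinear_scope.
Variable C : numClosedFieldType.

Lemma gram_form_ge0 (m n : nat) (A : 'M[C]_(m, n)) (v : 'cV[C]_n) :
  0 <= (v^t* *m (A^t* *m A) *m v) 0 0.
Proof.
have -> : v^t* *m (A^t* *m A) *m v = (A *m v)^t* *m (A *m v).
  by rewrite trmxC_mul !mulmxA.
by have := fdot_ge0 (A *m v); rewrite /fdot /mxtrace big_ord1.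
Qed.

Lemma gram_spectral (m n : nat) (A : 'M[C]_(m, n)) (G := A^t* *m A) :
  G = udiag (spectralmx G) (spectral_diag G 0) /\
  forall j, 0 <= spectral_diag G 0 j.
Proof.
have GE : G = udiag (spectralmx G) (spectral_diag G 0).
  apply: hermsymmx_udiag; apply/is_hermitianmxP.
  by rewrite expr0 scale1r trmxC_mul trmxCK.
split=> // j.
have [v <-] := udiag_form_coef (spectral_diag G 0) j (spectral_unitarymx G).
by rewrite -GE gram_form_ge0.
Qed.

Lemma sv_data_sort (m n : nat) (A : 'M[C]_(m, n)) V a (s : seq C) :
  V \is unitarymx -> A^t* *m A = udiag V (fun j => a j ^+ 2) ->
  (forall j, 0 <= a j) -> perm_eq s [seq a j | j <- enum 'I_n] ->
  sorted >=%R s ->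
  exists p : 'S_n, sv_data A (row_perm p V) (fun j => s`_j).
Proof.
move=> Vu AA a0 pe ss; have sz : size s = n.
  by rewrite (perm_size pe) size_map size_enum_ord.
have [p pu pE] := udiag_sort Vu pe; exists p; split=> //.
(* The permutation is known to work for [a]; multiplicativity of [udiag] carries it over to the
   squares. *)
- rewrite AA; transitivity (udiag V a *m udiag V a); first by rewrite udiagM.
  by rewrite -pE udiagM.
- move=> j; have : s`_j \in s by rewrite mem_nth// sz.
  by rewrite (perm_mem pe) => /mapP[i _ ->].
- by move=> i j ij; apply: sorted_ge_nth; rewrite // ij sz ltn_ord.
Qed.

Lemma fdot_eq0 (m n : nat) (A : 'M[C]_(m, n)) : fdot A A = 0 -> A = 0.
Proof.
have pos j i : 0 <= (A i j)^* * A i j by rewrite mulrC mul_conjC_ge0.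
rewrite fdotE => /eqP; rewrite psumr_eq0 => [/allP h|j _]; last exact: sumr_ge0.
apply/matrixP => i j; rewrite mxE.
have /(_ j) := h; rewrite mem_index_enum => /(_ isT)/=.
rewrite psumr_eq0// => /allP/(_ i); rewrite mem_index_enum => /(_ isT)/=.
by rewrite mulrC mul_conjC_eq0 => /eqP.
Qed.

(** A zero tail makes the truncation error vanish, so [A] equals its product with a projector of
    rank at most [k]. The converse is [sv_data_rank]. *)
Lemma tail_eq0 (m n k : nat) (A : 'M[C]_(m, n)) V s : sv_data A V s ->
  (tail k s == 0) = (\rank A <= k)%N.
Proof.
move=> As; apply/eqP/idP => [t0|rk]; last first.
  by apply: big1 => j kj; apply: (sv_data_rank As); exact: leq_trans kj.
have := fdot_truncation k As; rewrite t0 expr2 mulr0 /= => h.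
have /fdot_eq0/eqP : fdot (A - A *m udiag V (@head_ind C n k))
    (A - A *m udiag V (@head_ind C n k)) = 0.
  by apply/eqP; rewrite eq_le h fdot_ge0.
rewrite subr_eq0 => /eqP ->; rewrite (leq_trans (mxrankM_maxr _ _))//.
by rewrite udiag_rank_le// => j kj; rewrite /head_ind ltnNge kj.
Qed.

End Gram.

(** * Transfer of the estimates to [sigma_tail] *)

Section SigmaTail.
Local Open Scope complex_scope.
Local Open Scope sesquilinear_scope.
Variable R : realType.

Lemma realCX (x : R) n : (x ^+ n)%:C = x%:C ^+ n.
Proof. exact: rmorphXn. Qed.

Lemma realCM (x y : R) : (x * y)%:C = x%:C * y%:C.
Proof. exact: rmorphM. Qed.

Lemma realCn n : (n%:R : R)%:C = n%:R.
Proof. exact: rmorph_nat. Qed.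

Lemma realC_sum I (r : seq I) (P : pred I) (F : I -> R) :
  (\sum_(i <- r | P i) F i)%:C = \sum_(i <- r | P i) (F i)%:C.
Proof. exact: rmorph_sum. Qed.

Lemma sigma_sv_data (m n : nat) (A : 'M[R[i]]_(m, n)) :
  exists V (l : 'I_n -> R), sv_data A V (fun j => (l j)%:C) /\
  forall k, \sum_(k.+1 <= i < (minn m n).+1) sigma A i =
    \sum_(j < n | (k <= j)%N) l j.
Proof.
have [GE d0] := gram_spectral A.
set G := (_ *m _) in GE d0.
pose d j := Num.sqrt (complex.Re (spectral_diag G 0 j)).
pose L := sort >=%R [seq d j | j <- enum 'I_n].
have szL : size L = n by rewrite size_sort size_map size_enum_ord.
have AA : A^t* *m A = udiag (spectralmx G) (fun j => (d j)%:C ^+ 2).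
  rewrite -/G {1}GE; apply: eq_udiag => j; rewrite -realCX sqr_sqrtr.
    by rewrite RRe_real// ger0_real.
  by have := d0 j; rewrite lecE => /andP[].
have dC0 j : 0 <= (d j)%:C by rewrite ler0c sqrtr_ge0.
have pe : perm_eq [seq x%:C | x <- L] [seq (d j)%:C | j <- enum 'I_n].
  by rewrite (map_comp (real_complex R) d) perm_map// perm_sort.
have sL : sorted >=%R L.
  by apply: sort_sorted => x y; exact: le_total.
have sLC : sorted >=%R [seq x%:C | x <- L].
  by apply: homo_sorted sL => x y; rewrite /= lecR.
have [p svp] := sv_data_sort (spectral_unitarymx G) AA dC0 pe sLC.
have sv : sv_data A (row_perm p (spectralmx G)) (fun j : 'I_n => (L`_j)%:C).
  move: svp; congr sv_data; apply/funext => j.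
  by rewrite (nth_map 0) ?szL.
exists (row_perm p (spectralmx G)), (fun j => L`_j); split=> // k.
(* The one-based [sigma] is shifted to zero-based entries of [L]. It stops at [minn m n] whereas the
   tail runs up to [n]; the additional entries vanish since their index is at least the rank. *)
rewrite big_add1 /= big_nat (eq_bigr (fun i => L`_i)); last first.
  by move=> i /andP[_ im]; rewrite /sigma /singular_values nth_take.
rewrite -big_nat big_geq_mkord (big_ord_widen_cond n) ?geq_minr//=.
rewrite [RHS]big_mkcond [LHS]big_mkcond; apply: eq_bigr => j _.
case: (leqP k j) => // kj; case: (ltnP j (minn m n)) => // mj.
have rk : (\rank A <= j)%N.
  by rewrite (leq_trans _ mj)// leq_min rank_leq_row rank_leq_col.
by have /(congr1 (@complex.Re R))/= := sv_data_rank sv rk.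
Qed.

Lemma fdot_map_mx (m n : nat) (X : rectmx R m n) :
  fdot (map_mx (real_complex R) X) (map_mx (real_complex R) X) = (`|X| ^+ 2)%:C.
Proof.
rewrite rect_normE sqr_sqrtr; last by have [_ _ _ ->] := rect_dotP R m n.
rewrite fdotE rect_dotE realC_sum; apply: eq_bigr => j _.
rewrite realC_sum; apply: eq_bigr => i _; rewrite !mxE rmorphM.
by rewrite (CrealP _)// complex_real.
Qed.

Lemma fdot_hermx (n : nat) (X : hermx R n) :
  fdot (hermx_val X) (hermx_val X) = (`|X| ^+ 2)%:C.
Proof.
rewrite herm_normE sqr_sqrtr; last by have [_ _ _ ->] := herm_dotP R n.
by rewrite /herm_dot -/(fdot _ _) RRe_real// ger0_real// fdot_ge0.
Qed.

Lemma fdot_to_cmx (s : mspace) (X : mspace_type R s) :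
  fdot (to_cmx X) (to_cmx X) = (`|X| ^+ 2)%:C.
Proof. by case: s X => [n1 n2|n] X; [exact: fdot_map_mx|exact: fdot_hermx]. Qed.

Lemma to_cmxB (s : mspace) (X Y : mspace_type R s) :
  to_cmx (X - Y) = to_cmx X - to_cmx Y.
Proof. by case: s X Y => [n1 n2|n] X Y //=; rewrite map_mxB. Qed.

Lemma mrank_to_cmx (s : mspace) (X : mspace_type R s) :
  mrank X = \rank (to_cmx X).
Proof. by case: s X => [n1 n2|n] X //=; rewrite mxrank_map. Qed.

Lemma sv_data_to_cmx (s : mspace) (X : mspace_type R s) :
  exists V l, sv_data (to_cmx X) V l /\
    forall k, tail k l = (sigma_tail k X)%:C.
Proof.
have [V [l [sv lE]]] := sigma_sv_data (to_cmx X).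
exists V, (fun j => (l j)%:C); split=> // k.
by rewrite /sigma_tail lE realC_sum.
Qed.

(** By uniqueness, whichever decomposition is convenient computes [sigma_tail]. *)
Lemma tail_to_cmx (s : mspace) (X : mspace_type R s) V l k :
  sv_data (to_cmx X) V l -> tail k l = (sigma_tail k X)%:C.
Proof.
by have [U [t [Xt <-]]] := sv_data_to_cmx X => Xl; exact: tail_unique Xl Xt.
Qed.

Lemma sigma_tail_ge0 (s : mspace) (X : mspace_type R s) k : 0 <= sigma_tail k X.
Proof.
have [U [t [[_ _ t0 _] tE]]] := sv_data_to_cmx X.
by rewrite -ler0c -tE; exact: tail_ge0.
Qed.

Lemma sqrtC_real (x : R) : 0 <= x -> sqrtC x%:C = (Num.sqrt x)%:C.
Proof.
by move=> x0; rewrite -{1}(sqr_sqrtr x0) realCX sqrCK// ler0c sqrtr_ge0.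
Qed.

Lemma sigma_tail_lipschitz (s : mspace) (X Y : mspace_type R s) k :
  sigma_tail k X <= sigma_tail k Y + Num.sqrt (mdim s)%:R * `|X - Y|.
Proof.
have [U [t [Xt tE]]] := sv_data_to_cmx X.
have [V [l [Yl lE]]] := sv_data_to_cmx Y.
have := tail_lipschitz k Xt Yl.
rewrite tE lE -to_cmxB fdot_to_cmx.
have -> : (minn (nrow s) (ncol s))%:R = ((mdim s)%:R : R)%:C by rewrite
  rmorph_nat.
rewrite !sqrtC_real ?ler0n ?sqr_ge0// sqrtr_sqr normr_id.
by rewrite -rmorphM -rmorphD lecR.
Qed.

Lemma sigma_tail_eq0 (s : mspace) (X : mspace_type R s) k :
  (sigma_tail k X == 0) = (mrank X <= k)%N.
Proof.
have [U [t [Xt tE]]] := sv_data_to_cmx X.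
rewrite mrank_to_cmx -(tail_eq0 k Xt) tE.
by rewrite -(inj_eq (@complexI R)).
Qed.

End SigmaTail.

(** * Orthogonal diagonalization of real symmetric matrices *)

Section RealSpectral.
Local Open Scope sesquilinear_scope.

(** For a row eigenvector [v], both [v A v^*] and [v v^*] are self-adjoint scalars, and [a] is their
    ratio. *)
Lemma hermsymmx_eigenvalue_real (C : numClosedFieldType) n (A : 'M[C]_n) a :
  A \is hermsymmx -> eigenvalue A a -> a \is Num.real.
Proof.
move=> /is_hermitianmxP; rewrite expr0 scale1r => Ah /eigenvalueP[v vA v0].
have vv : (v *m v^t*) 0 0 != 0.
  apply: contra v0 => /eqP vv; have vt : v^t* = 0.
    apply: fdot_eq0; rewrite /fdot trmxCK.
    by rewrite /mxtrace big_ord1.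
  by rewrite -[v]trmxCK vt trmx0 map_mx0.
apply/CrealP; apply: (mulIf vv).
have vAv : (v *m A *m v^t*) 0 0 = a * (v *m v^t*) 0 0.
  by rewrite vA -scalemxAl mxE.
rewrite -vAv; have -> : v *m A *m v^t* = (v *m A *m v^t*)^t*.
  by rewrite !trmxC_mul trmxCK -Ah mulmxA.
rewrite trmxCE vAv rmorphM; congr (_ * _).
have {1}-> : v *m v^t* = (v *m v^t*)^t* by rewrite trmxC_mul trmxCK.
by rewrite trmxCE.
Qed.

Lemma mulmx_trE (F : realFieldType) n (u : 'rV[F]_n) :
  (u *m u^T) 0 0 = \sum_j u 0 j ^+ 2.
Proof. by rewrite mxE; apply: eq_bigr => j _; rewrite expr2; congr (_ * _);
  exact: mxE. Qed.

Lemma mulmx_tr_eq0 (F : realFieldType) n (u : 'rV[F]_n) :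
  (u *m u^T) 0 0 = 0 -> u = 0.
Proof.
rewrite mulmx_trE => /eqP; rewrite psumr_eq0 => [/allP h|j _];
  last exact: sqr_ge0.
apply/rowP => i; rewrite [RHS]mxE; apply/eqP; rewrite -sqrf_eq0.
exact: h (mem_index_enum i).
Qed.

(** Over the complex extension an eigenvalue exists and is real; it is then a root of the real
    characteristic polynomial, which provides a real eigenvector. *)
Lemma symmetric_eigenvector (R : rcfType) n (A : 'M[R]_n.+1) : A^T = A ->
  exists a (v : 'rV[R]_n.+1), v *m v^T = 1%:M /\ v *m A = a *: v.
Proof.
move=> At; pose B := map_mx (real_complex R) A.
have Bh : B \is hermsymmx.
  apply/is_hermitianmxP; rewrite expr0 scale1r; apply/matrixP => i j.
  rewrite trmxCE !mxE -{1}At mxE; apply/esym/CrealP.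
  by rewrite complex_real.
have [b Bb] := eigenvalue_closed B (ltn0Sn n).
have /complex_realP[a ab] := hermsymmx_eigenvalue_real Bh Bb.
have : eigenvalue A a.
  move: Bb; rewrite ab !eigenvalue_root_char.
  by rewrite -map_char_poly fmorph_root.
move=> /eigenvalueP[v vA v0].
have vv : 0 < (v *m v^T) 0 0.
  rewrite lt_def; apply/andP; split.
    by apply: contra v0 => /eqP/mulmx_tr_eq0/eqP.
  by rewrite mulmx_trE sumr_ge0// => i _; exact: sqr_ge0.
pose c := (Num.sqrt ((v *m v^T) 0 0))^-1.
exists a, (c *: v); split; last by rewrite -scalemxAl vA scalerA mulrC -scalerA.
rewrite linearZ/= -scalemxAl -scalemxAr scalerA [v *m v^T]mx11_scalar.
rewrite scale_scalar_mx; congr (_%:M);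
  rewrite /c -expr2 exprVn sqr_sqrtr ?ltW//.
by rewrite mulVf// gt_eqF.
Qed.

(** The reflection along [w = v - e] exchanges the unit vectors [e] and [v]. Its coefficient
    [b = 1 / (1 - x)] is 2 over the squared norm of [w]; when [x = 1], [v = e] and the identity
    serves. *)
Lemma householder (F : realFieldType) n (v : 'rV[F]_n.+1) : v *m v^T = 1%:M ->
  exists Q : 'M[F]_n.+1, Q *m Q^T = 1%:M /\ delta_mx 0 0 *m Q = v.
Proof.
move=> vv; pose e : 'rV[F]_n.+1 := delta_mx 0 0; pose w := v - e;
  pose x := v 0 0.
have ve : v *m e^T = x%:M.
  by rewrite trmx_delta -colE [LHS]mx11_scalar; congr _%:M; rewrite mxE.
have ev : e *m v^T = x%:M by rewrite -[e]trmxK -trmx_mul ve tr_scalar_mx.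
have ee : e *m e^T = 1%:M.
  by rewrite trmx_delta mul_delta_mx [LHS]mx11_scalar mxE.
have ew : e *m w^T = (x - 1)%:M by rewrite linearB/= mulmxBr ev ee raddfB.
have ww : w *m w^T = (2 * (1 - x))%:M.
  rewrite linearB/= mulmxBr !mulmxBl vv ve ev ee -!raddfB; congr _%:M.
  by rewrite /=; ring.
have [x1|x1] := eqVneq x 1.
  have w0 : w = 0.
    by apply: mulmx_tr_eq0; rewrite ww x1 subrr mulr0 mxE.
  exists 1%:M; rewrite trmx1 !mulmx1; split=> //.
  by apply/esym/eqP; rewrite -subr_eq0 -/e -/w w0.
pose b := (1 - x)^-1; have x1' : 1 - x != 0 by rewrite subr_eq0 eq_sym.
exists (1%:M - b *: (w^T *m w)); split; last first.
  rewrite -/e mulmxBr mulmx1 -scalemxAr mulmxA ew mul_scalar_mx scalerA.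
  have -> : b * (x - 1) = - 1 by rewrite /b; field.
  by rewrite scaleN1r opprK addrC subrK.
have -> : (1%:M - b *: (w^T *m w))^T = 1%:M - b *: (w^T *m w).
  by rewrite [LHS]linearB/= trmx1 linearZ/= trmx_mul trmxK.
set S := w^T *m w.
have SS : S *m S = (2 * (1 - x)) *: S.
  by rewrite /S mulmxA -[w^T *m w *m w^T]mulmxA ww mul_mx_scalar -scalemxAl.
rewrite mulmxBl mul1mx mulmxBr mulmx1 -scalemxAl -scalemxAr SS !scalerA.
rewrite -[1%:M - _ - _]addrA -opprD -scalerBl -scalerDl.
have -> : b + (b - b * b * (2 * (1 - x))) = 0.
  by rewrite /b; field.
by rewrite scale0r subr0.
Qed.

(** Deflation: a Householder matrix takes the first basis vector to a unit eigenvector, and by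
    symmetry the conjugated matrix splits into a scalar block and a smaller symmetric one. *)
Lemma symmetric_diagonalization (R : rcfType) n (A : 'M[R]_n) : A^T = A ->
  exists (V : 'M[R]_n) (d : 'rV[R]_n),
    V *m V^T = 1%:M /\ A = V^T *m diag_mx d *m V.
Proof.
elim: n A => [|n IH] A At.
  exists 1%:M, 0; split; first by rewrite trmx1 mulmx1.
  by apply/matrixP => -[].
have [a [v [vv vA]]] := symmetric_eigenvector At.
have [Q [QQ eQ]] := householder vv.
have QtQ : Q^T *m Q = 1%:M by exact: mulmx1C.
pose B : 'M[R]_(1 + n) := Q *m A *m Q^T.
have Bt : B^T = B by rewrite /B !trmx_mul trmxK At mulmxA.
have eB : delta_mx 0 0 *m B = a *: (delta_mx 0 0 : 'rV_(1 + n)).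
  rewrite /B !mulmxA eQ vA -scalemxAl; congr (_ *: _).
  by rewrite -eQ -mulmxA QQ mulmx1.
have B0 j : B 0 j = a *+ (j == 0).
  move/rowP : eB => /(_ j); rewrite -rowE !mxE eqxx/= => ->.
  by rewrite mulr_natr eq_sym.
have BQ : B = Q *m A *m Q^T by []; clearbody B.
pose A' := drsubmx B.
have At' : A'^T = A' by rewrite /A' trmx_drsub Bt.
have [V [d [VV AV]]] := IH A' At'.
have BE : B = block_mx a%:M 0 0 A'.
  have l0 : lshift n (0 : 'I_1) = 0 by apply: val_inj.
  rewrite -[LHS]submxK; congr block_mx; apply/matrixP => i j.
  - by rewrite !ord1 !mxE l0 B0.
  - by rewrite ord1 !mxE l0 B0.
  - by rewrite ord1 !mxE l0 -Bt mxE B0.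
pose W : 'M[R]_(1 + n) := block_mx 1%:M 0 0 V.
have Wt : W^T = block_mx 1%:M 0 0 V^T by rewrite tr_block_mx trmx1 !trmx0.
have WW : W *m W^T = 1%:M.
  rewrite Wt /W mulmx_block !mulmx0 !mul0mx !addr0 add0r mulmx1 VV.
  by rewrite -scalar_mx_block.
have WB : W^T *m diag_mx (row_mx a%:M d) *m W = B.
  rewrite Wt /W diag_mx_row !mulmx_block !(mulmx0, mul0mx, addr0, add0r,
    mulmx1, mul1mx).
  rewrite -AV BE; congr block_mx.
  by apply/matrixP => i j; rewrite !ord1 !mxE eqxx.
exists (W *m Q), (row_mx a%:M d); split.
  by rewrite trmx_mul mulmxA -[W *m Q *m _]mulmxA QQ mulmx1.
have -> : (W *m Q)^T *m diag_mx (row_mx a%:M d) *m (W *m Q) =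
    Q^T *m (W^T *m diag_mx (row_mx a%:M d) *m W) *m Q.
  by rewrite trmx_mul !mulmxA.
by rewrite WB BQ !mulmxA QtQ mul1mx -mulmxA QtQ mulmx1.
Qed.

End RealSpectral.

(** * Low-rank truncation inside the space of real matrices *)

Section RealTruncation.
Local Open Scope complex_scope.
Local Open Scope sesquilinear_scope.

Lemma map_mx_adj (R : rcfType) (m n : nat) (A : 'M[R]_(m, n)) :
  (map_mx (real_complex R) A)^t* = map_mx (real_complex R) A^T.
Proof.
apply/matrixP => i j; rewrite trmxCE !mxE; apply/CrealP.
by rewrite complex_real.
Qed.

Lemma map_mx_congruence (R : rcfType) (C : numClosedFieldType)
    (f : {rmorphism R -> C}) (n : nat) (W : 'M[R]_n) (a : 'I_n -> R) :
  (forall x, f x \is Num.real) ->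
  map_mx f (W^T *m diag_mx (\row_j a j) *m W) =
  udiag (map_mx f W) (fun j => f (a j)).
Proof.
move=> fr; rewrite 2!map_mxM map_diag_mx /udiag.
congr (_ *m diag_mx _ *m _); last by apply/rowP => j; rewrite !mxE.
by apply/matrixP => i j; rewrite trmxCE !mxE (CrealP (fr _)).
Qed.

Lemma congruence_idempotent (F : comNzRingType) (n : nat) (W D : 'M[F]_n) :
  W *m W^T = 1%:M -> D *m D = D ->
  (W^T *m D *m W) *m (W^T *m D *m W) = W^T *m D *m W.
Proof.
move=> WW DD; transitivity (W^T *m D *m (W *m W^T) *m D *m W).
  by rewrite !mulmxA.
by rewrite WW mulmx1 -[W^T *m D *m D]mulmxA DD.
Qed.

(** A real diagonalization of [X^T X] gives a real projector, so [X P] stays real; its error is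
    estimated after embedding into complex matrices. *)
Lemma real_truncation (R : realType) (m n k : nat) (X : rectmx R m n) :
  exists P : 'M[R]_n, [/\ P^T = P, P *m P = P, (\rank P <= k)%N &
    `|X - (X *m P : rectmx R m n)| <=
      sigma_tail k (X : mspace_type R (Rect m n))].
Proof.
pose inj := real_complex R.
pose cX := map_mx inj (X : 'M[R]_(m, n)).
have [V [d [VV XX]]] : exists (V : 'M[R]_n) (d : 'rV[R]_n),
    V *m V^T = 1%:M /\ (X : 'M[R]_(m, n))^T *m X = V^T *m diag_mx d *m V.
  by apply: symmetric_diagonalization; rewrite trmx_mul trmxK.
have unit_map (W : 'M[R]_n) : (map_mx inj W \is unitarymx) = (W *m W^T == 1%:M).
  rewrite qualifE /unitarymx map_mx_adj -(map_mxM inj) -(map_mx1 inj).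
  exact: (inj_eq (@map_mx_inj _ _ inj _ _)).
have udiag_map (W : 'M[R]_n) (a : 'I_n -> R) :
    map_mx inj (W^T *m diag_mx (\row_j a j) *m W) =
    udiag (map_mx inj W) (fun j => (a j)%:C).
  by apply: map_mx_congruence => x; rewrite complex_real.
pose U := map_mx inj V.
have Uu : U \is unitarymx by rewrite unit_map VV.
have cXX : cX^t* *m cX = udiag U (fun j => (d 0 j)%:C).
  rewrite map_mx_adj -map_mxM XX -udiag_map;
    congr (map_mx _ (_ *m diag_mx _ *m _)).
  by apply/rowP => j; rewrite mxE.
have d0 j : 0 <= d 0 j.
  rewrite -ler0c; have [v <-] := udiag_form_coef (fun j => (d 0 j)%:C) j Uu.
  by rewrite -cXX; exact: gram_form_ge0.
pose a j := (Num.sqrt (d 0 j))%:C.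
have a0 j : 0 <= a j by rewrite ler0c sqrtr_ge0.
have cXa : cX^t* *m cX = udiag U (fun j => a j ^+ 2).
  by rewrite cXX; apply: eq_udiag => j; rewrite -realCX sqr_sqrtr.
pose l := [seq a j | j <- enum 'I_n].
have pe : perm_eq (sort >=%R l) l by rewrite perm_sort.
have ls : sorted >=%R (sort >=%R l).
  apply: sort_real_sorted => x /mapP[j _ ->]; exact: ger0_real.
have [p svp] := sv_data_sort Uu cXa a0 pe ls.
pose W := row_perm p V.
have WU : row_perm p U = map_mx inj W by rewrite map_row_perm.
rewrite WU in svp.
(* Sorting has been carried into the rows of [W], so this projects onto the top [k] right singular
   vectors. *)
pose P := W^T *m diag_mx (\row_j ((j < k)%N%:R : R)) *m W.
have PE : map_mx inj P = udiag (map_mx inj W) (@head_ind R[i] n k).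
  by rewrite udiag_map; apply: eq_udiag => j; rewrite /head_ind rmorph_nat.
have Wu : map_mx inj W \is unitarymx by case: svp.
exists P; split.
- by rewrite /P !trmx_mul trmxK tr_diag_mx mulmxA.
- apply: congruence_idempotent; first by apply/eqP; rewrite -unit_map.
  rewrite mulmx_diag; congr diag_mx; apply/rowP => j; rewrite !mxE.
  by case: (j < k)%N; rewrite ?mulr0 ?mulr1.
- rewrite -(mxrank_map inj) PE udiag_rank_le// => j kj.
  by rewrite /head_ind ltnNge kj.
- have := fdot_truncation k svp.
  rewrite (@tail_to_cmx R (Rect m n) X _ _ k svp) /= -PE -map_mxM -map_mxB.
  rewrite (fdot_map_mx (X - (X *m P : rectmx R m n))) -realCX lecR.
  by rewrite ler_pXn2r// qualifE/= ?sigma_tail_ge0.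
Qed.

End RealTruncation.

(** * Distance to a set and the compactness argument *)

Section Distance.
Variables (R : realType) (V : normedModType R).
Implicit Types (x y : V) (A : set V).

Lemma dist_le x y A : A y -> dist x A <= `|x - y|.
Proof.
move=> Ay; apply: ge_inf; last by exists y.
by exists 0 => _ [z _ <-].
Qed.

(** Nonemptiness matters: the infimum of the empty set is 0 by convention. *)
Lemma dist_ge x A (d : R) : A !=set0 -> (forall y, A y -> d <= `|x - y|) ->
  d <= dist x A.
Proof.
move=> [y Ay] h; apply: lb_le_inf; first by exists `|x - y|, y.
by move=> _ [z Az <-]; exact: h.
Qed.

Lemma dist_le_normD x y A : A !=set0 -> dist x A <= `|x - y| + dist y A.
Proof.
move=> A0; rewrite -lerBlDl; apply: dist_ge => // z Az.
rewrite lerBlDl (le_trans (dist_le _ Az))//.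
by rewrite -[x - z](subrKA y) ler_normD.
Qed.

(* Around a point of level 0 the bound is calmness; around any other point of
   Omega it holds because T stays away from 0. *)
Lemma calm_dist_le (T : V -> R) (r : R) (Omega : set V)
    (G := fun w : R^o => [set x | Omega x /\ T x = w]) :
  0 <= r -> (forall x, 0 <= T x) ->
  (forall x y, T x <= T y + r * `|x - y|) ->
  compact Omega -> G 0 !=set0 -> (forall x, G 0 x -> calm G 0 x) ->
  exists c : R, 0 < c /\ forall x, Omega x -> dist x (G 0) <= c * T x.
Proof.
move=> r0 T0 Tlip cO F0 hcalm; set F := G 0.
pose P (c : R) (Y : V) := Omega Y -> dist Y F <= c * T Y.
have cover X : Omega X -> \forall Y \near X & c \near +oo, P c Y.
  move=> OX; have [t0|t0] := eqVneq (T X) 0.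
    have [al [U [W [al0 nU nW UW]]]] := hcalm X (conj OX t0).
    have /nbhs_ballP[e /= e0 eU] := nU.
    (* As [T X = 0] and [T] is [r]-Lipschitz, this radius forces [T Y < e], so calmness applies at
       level [T Y]. Using [r + 1] keeps the denominator positive. *)
    exists (W `&` ball X (e / (r + 1)), [set c | al < c]) => /=.
      split; last by exists al; rewrite num_real.
      by apply: filterI => //; apply: nbhsx_ballx; rewrite divr_gt0// ltr_wpDl.
    move=> [Y c] [/= [WY]]; rewrite -ball_normE /= => XY alc OY.
    have tY : T Y < e.
      have := Tlip Y X; rewrite t0 add0r distrC => h.
      apply: (le_lt_trans h); move: XY; rewrite ltr_pdivlMr ?ltr_wpDl// => XY.
      apply: le_lt_trans XY; rewrite mulrC ler_wpM2l//; lra.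
    have UY : U (T Y).
      by apply: eU; rewrite -ball_normE /= sub0r normrN ger0_norm ?T0.
    have [Z GZ [b b1 YE]] := UW _ UY Y (conj (conj OY erefl) WY).
    apply: le_trans (dist_le _ GZ) _.
    have st0 : 0 <= T Y by exact: T0.
    have -> : `|Y - Z| = al * T Y * `|b|.
      rewrite -{1}YE addrC addKr normrZ subr0 (ger0_norm st0).
      by rewrite ger0_norm// mulr_ge0.
    apply: (@le_trans _ _ (al * T Y)).
      by rewrite ler_piMr// mulr_ge0.
    by rewrite ler_wpM2r ?T0// ltW.
  have tp : 0 < T X by rewrite lt_def t0 T0.
  have [Z FZ] := F0.
  pose D := `|X - Z| + 1; have D0 : 0 < D by rewrite ltr_wpDl.
  (* Radius 1 keeps the distance to [F] below [D]; the other radius keeps [T] at least half of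
     [T X]. Their ratio is the threshold for [c]. *)
  pose e := Num.min 1 (T X / 2 / (r + 1)).
  exists (ball X e, [set c | D / (T X / 2) < c]) => /=.
    split; last by exists (D / (T X / 2)); rewrite num_real.
    by apply: nbhsx_ballx; rewrite lt_min ltr01 !divr_gt0// ltr_wpDl.
  move=> [Y c] [/=]; rewrite -ball_normE /= lt_min => /andP[XY1 XYe] cD OY.
  have tY : T X / 2 <= T Y.
    have := Tlip X Y.
    move: XYe; rewrite ltr_pdivlMr ?ltr_wpDl// => XYe h.
    have : r * `|X - Y| <= `|X - Y| * (r + 1) by rewrite mulrC ler_wpM2l//; lra.
    lra.
  have dY : dist Y F <= D.
    apply: (le_trans (dist_le _ FZ)).
    rewrite -[Y - Z](subrKA X) (le_trans (ler_normD _ _))// addrC lerD2l.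
    by rewrite distrC ltW.
  apply: (le_trans dY); rewrite -ler_pdivrMr; last first.
    by rewrite (lt_le_trans _ tY)// divr_gt0.
  rewrite (le_trans _ (ltW cD))// ler_pM2l// lef_pV2 ?qualifE/= ?divr_gt0//.
  by rewrite (lt_le_trans _ tY)// divr_gt0.
(* Compactness as a near-covering property merges the local thresholds for [c] into one [M] for all
   of [Omega]. *)
have /compact_near_coveringP/(_ _ _ P _ cover) := cO.
move=> [M [_ hM]].
pose c := Num.max M 0 + 1.
have Mc : M < c by rewrite /c (le_lt_trans (_ : _ <= Num.max M 0)) ?le_max
  ?lexx ?ltrDl.
have c0 : 0 < c by rewrite /c ltr_wpDl// le_max lexx orbT.
by exists c; split=> // X OX; exact: hM.
Qed.

End Distance.

(** * From estimates on [Omega] to the four error bounds *)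

Section ErrorBounds.
Local Open Scope complex_scope.
Local Open Scope sesquilinear_scope.
Variable R : realType.

(** Pass through a point [Y] of [Omega]: the Lipschitz estimate replaces the tail of [Y] by that of
    [X] at the cost of [c * r] times the distance between them. *)
Lemma error_bound_of_level (s : mspace) (Omega : set (mspace_type R s)) k c :
  0 <= c -> rank_constrained Omega k !=set0 ->
  (forall X, Omega X -> dist X (rank_constrained Omega k) <=
    c * sigma_tail k X) ->
  error_bound Omega k c.
Proof.
move=> c0 F0 h X; set r := Num.sqrt _.
have r0 : 0 <= r by exact: sqrtr_ge0.
have cr : 0 < 1 + c * r by rewrite ltr_wpDr// mulr_ge0.
have O0 : Omega !=set0 by case: F0 => Y [OY _]; exists Y.
(* Dividing by [1 + c * r] leaves a lower bound to be proved for each [Y], so no nearest point of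
   [Omega] has to exist. *)
rewrite -lerBlDr [leRHS]mulrC -ler_pdivrMr//; apply: dist_ge => // Y OY.
rewrite ler_pdivrMr// lerBlDr.
apply: (le_trans (dist_le_normD X Y F0)).
have := sigma_tail_lipschitz Y X k; rewrite -/r distrC.
move=> /(ler_wpM2l c0); have := h Y OY.
set t := sigma_tail k Y; set u := sigma_tail k X; set e := `|X - Y|.
by rewrite mulrDr => h1 h2;
  rewrite (le_trans (lerD (lexx e) (le_trans h1 h2)))//; lra.
Qed.

Lemma error_bound_of_approx (s : mspace) (Omega : set (mspace_type R s)) k c :
  0 <= c -> rank_constrained Omega k !=set0 ->
  (forall X, Omega X -> exists2 Y, rank_constrained Omega k Y &
     `|X - Y| <= c * sigma_tail k X) ->
  error_bound Omega k c.
Proof.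
move=> c0 F0 h; apply: error_bound_of_level => // X /h[Y FY XY].
exact: le_trans (dist_le _ FY) XY.
Qed.

(** The rank constraint is the zero level of the tail, so the compactness argument applies with the
    tail as [T]. *)
Lemma calm_error_bound (s : mspace) (Omega : set (mspace_type R s)) (k : nat) :
  compact Omega -> rank_constrained Omega k !=set0 ->
  (forall X, tail_level Omega k 0 X -> calm (tail_level Omega k) 0 X) ->
  exists c : R, 0 < c /\ error_bound Omega k c.
Proof.
move=> cO F0 hcalm.
have FE : rank_constrained Omega k = tail_level Omega k 0.
  apply/seteqP; split=> X [OX]; first by rewrite -sigma_tail_eq0 => /eqP.
  by move/eqP; rewrite sigma_tail_eq0.
have F0' := F0; rewrite FE in F0'.
have [c [c0 h]] := calm_dist_le (sqrtr_ge0 (mdim s)%:R)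
  (@sigma_tail_ge0 R s ^~ k) (fun X Y => sigma_tail_lipschitz X Y k) cO F0'
    hcalm.
exists c; split=> //; apply: error_bound_of_level => //; first exact: ltW.
by move=> X OX; rewrite FE; exact: h.
Qed.

Lemma rect_normD_sqr (m n : nat) (A B : rectmx R m n) : rect_dot A B = 0 ->
  `|A + B| ^+ 2 = `|A| ^+ 2 + `|B| ^+ 2.
Proof.
have [dC dD _ d0 _] := rect_dotP R m n => AB.
rewrite !rect_normE !sqr_sqrtr// dD (dC A) (dC B) !dD (dC B A) AB.
by rewrite addr0 add0r.
Qed.

Lemma projection_orthogonal (F : comNzRingType) (m n : nat) (X : 'M[F]_(m, n))
    (P : 'M[F]_n) :
  P^T = P -> P *m P = P -> \tr ((X - X *m P)^T *m (X *m P)) = 0.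
Proof.
move=> Pt PP; have -> : (X - X *m P)^T = (1%:M - P) *m X^T.
  by rewrite linearB/= trmx_mul Pt mulmxBl mul1mx.
have PQ : P *m (1%:M - P) = 0 by rewrite mulmxBr mulmx1 PP subrr.
rewrite -mulmxA mxtrace_mulC -[_ *m (1%:M - P)]mulmxA -[X *m P *m _]mulmxA PQ.
by rewrite !mulmx0 mxtrace0.
Qed.

(* If Y leaves the ball, scaling it back to the sphere moves it, orthogonally
   to X - Y, by (N Y - gamma) |Y| / N Y <= N (Y - X) / cl. *)
Lemma ball_rescaling (m n : nat) (N : rectmx R m n -> R) (gamma cl cu : R)
    (X Y : rectmx R m n) :
  is_norm N -> 0 < gamma -> 0 < cl -> 0 < cu ->
  (forall Z : rectmx R m n, cl * `|Z| <= N Z <= cu * `|Z|) ->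
  N X <= gamma -> rect_dot (X - Y) Y = 0 ->
  exists t, N (t *: Y) <= gamma /\
    `|X - t *: Y| <= Num.sqrt (1 + cu ^+ 2 / cl ^+ 2) * `|X - Y|.
Proof.
move=> [ND NZ _] g0 cl0 cu0 NE NX orth.
have q0 : 0 <= cu ^+ 2 / cl ^+ 2 by rewrite divr_ge0// sqr_ge0.
have sq : 0 <= 1 + cu ^+ 2 / cl ^+ 2 by rewrite addr_ge0.
have [NY|NY] := leP (N Y) gamma.
  exists 1; rewrite scale1r; split=> //.
  by rewrite ler_peMl// -[leLHS]sqrtr1 ler_wsqrtr// lerDl.
have NY0 : 0 < N Y by exact: lt_trans NY.
pose t := gamma / N Y.
have t0 : 0 <= t by rewrite divr_ge0 ?ltW.
have t1 : 0 <= 1 - t by rewrite subr_ge0 ltW// ltr_pdivrMr// mul1r.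
have tNY : t * N Y = gamma by rewrite mulfVK// gt_eqF.
exists t; split; first by rewrite NZ ger0_norm// tNY.
rewrite -(ler_pXn2r (ltn0Sn 1)) ?qualifE/= ?mulr_ge0 ?sqrtr_ge0//.
rewrite exprMn (sqr_sqrtr sq).
(* The truncation error and the rescaling displacement are orthogonal, so their squares add: hence
   the constant [Num.sqrt (1 + cu ^+ 2 / cl ^+ 2)]. *)
have -> : X - t *: Y = (X - Y) + (1 - t) *: Y.
  by rewrite scalerBl scale1r addrA subrK.
have [dC _ dZ _ _] := rect_dotP R m n.
have orthZ : rect_dot (X - Y) ((1 - t) *: Y) = 0.
  by apply: etrans (dC _ _) _; apply: etrans (dZ _ _ _) _;
    rewrite dC orth mulr0.
rewrite (rect_normD_sqr orthZ).
rewrite normrZ (ger0_norm t1).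
have key : (1 - t) * `|Y| <= cu / cl * `|X - Y|.
  have /andP[NY1 _] := NE Y; have /andP[_ NYX] := NE (Y - X).
  have NYD : N Y <= N (Y - X) + N X by rewrite -{1}(subrK X Y) ND.
  rewrite -(ler_pM2l cl0) mulrCA (le_trans (ler_wpM2l t1 NY1))//.
  rewrite mulrBl mul1r tNY mulrA mulrCA mulfV ?gt_eqF// mulr1 distrC.
  by move: NYX NYD NX; set u := cu * _; lra.
have key2 : ((1 - t) * `|Y|) ^+ 2 <= cu ^+ 2 / cl ^+ 2 * `|X - Y| ^+ 2.
  rewrite -exprVn -!exprMn lerXn2r ?qualifE/= ?mulr_ge0// ?invr_ge0 ?ltW//.
rewrite (le_trans (lerD (lexx _) key2))//.
by rewrite -[X in X + _]mul1r -mulrDl.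
Qed.

(* X P is the average of X and of its image under the reflection 2 P - 1. *)
Lemma unitarily_invariant_projection (m n : nat) (N : rectmx R m n -> R)
    (P : 'M[R]_n) (X : rectmx R m n) :
  is_norm N -> unitarily_invariant N -> P^T = P -> P *m P = P ->
  N (X *m P) <= N X.
Proof.
move=> [ND NZ _] Ninv Pt PP; pose V := P + P - 1%:M.
have VV : V *m V^T = 1%:M.
  have -> : V^T = V by rewrite /V linearB/= linearD/= Pt trmx1.
  rewrite /V mulmxBr mulmx1 mulmxBl mul1mx mulmxDr !mulmxDl PP.
  by rewrite addrK opprB addrC subrK.
have NV : N (X *m V) = N X.
  by rewrite -[X *m V]mul1mx mulmxA Ninv// trmx1 mulmx1.
have XPE : (X *m P : rectmx R m n) = 2^-1 *: (X + (X *m V : rectmx R m n)).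
  have XVE : X *m V = X *m P + X *m P - X by rewrite mulmxBr mulmx1 mulmxDr.
  have half : 2^-1 + 2^-1 = 1 :> R by lra.
  by rewrite XVE addrC subrK scalerDr -scalerDl half scale1r.
rewrite XPE NZ ger0_norm ?invr_ge0// mulrC ler_pdivrMr//.
by rewrite (le_trans (ND _ _))// NV mulr_natr mulr2n.
Qed.

Lemma norm_ball_error_bound (m n k : nat) (N : rectmx R m n -> R)
    (gamma cl cu : R) :
  is_norm N -> 0 < gamma -> 0 < cl -> 0 < cu ->
  (forall X : rectmx R m n, cl * `|X| <= N X <= cu * `|X|) ->
  let Omega : set (mspace_type R (Rect m n)) := [set X | N X <= gamma] in
  error_bound Omega k (Num.sqrt (1 + cu ^+ 2 / cl ^+ 2)) /\
  (unitarily_invariant N -> error_bound Omega k 1).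
Proof.
move=> hN g0 cl0 cu0 NE Omega.
have F0 : rank_constrained Omega k !=set0.
  exists 0; split => /=; last by rewrite mxrank0.
  have /andP[_] := NE 0; rewrite normr0 mulr0 => h.
  exact: le_trans h (ltW g0).
split=> [|Ninv]; apply: error_bound_of_approx => //.
  move=> X OX; have [P [Pt PP rP XP]] := real_truncation k (X : rectmx R m n).
  have orth : rect_dot ((X : rectmx R m n) - (X *m P : rectmx R m n)) (X *m P)
    = 0.
    exact: projection_orthogonal.
  have [t [Nt Xt]] := ball_rescaling hN g0 cl0 cu0 NE OX orth.
  exists (t *: (X *m P)).
    split=> //=; rewrite (leq_trans (mxrank_scale _ _))//.
    by rewrite (leq_trans (mxrankM_maxr _ _)).
  by apply: (le_trans Xt); rewrite ler_wpM2l ?sqrtr_ge0.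
(* Under unitary invariance the truncation already lies in the ball, so the truncation error is the
   only one. *)
move=> X OX; have [P [Pt PP rP XP]] := real_truncation k (X : rectmx R m n).
exists (X *m P); last by rewrite mul1r.
split; last by rewrite /= (leq_trans (mxrankM_maxr _ _)).
by apply: (@le_trans _ _ (N X)) OX; exact: unitarily_invariant_projection.
Qed.

Lemma hermx_norm_le (n : nat) (X : hermx R n) (c : R) : 0 <= c ->
  fdot (hermx_val X) (hermx_val X) <= c%:C ^+ 2 -> `|X| <= c.
Proof.
move=> c0; rewrite fdot_hermx -realCX lecR ler_pXn2r//.
by rewrite qualifE/=; exact: normr_ge0.
Qed.

Lemma possemidef_udiag (n : nat) (V : 'M[R[i]]_n) a : (forall j, 0 <= a j) ->
  possemidef (udiag V a).
Proof.
move=> a0; split; last exact: udiag_form_ge0.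
by rewrite hermxE udiag_adj// => j; exact: ger0_real.
Qed.

Lemma unit_trace_error_bound (n k : nat) : (0 < n)%N -> (0 < k)%N ->
  let Omega : set (mspace_type R (Herm n)) :=
    [set X : hermx R n | possemidef X /\ \tr X = 1] in
  error_bound Omega k (Num.sqrt 2).
Proof.
move=> n0 k0 Omega.
have one_unit : (1%:M : 'M[R[i]]_n) \is unitarymx.
  by apply/unitarymxP; rewrite trmx1 map_mx1 mulmx1.
apply: error_bound_of_approx; first exact: sqrtr_ge0.
  (* A feasible point: the diagonal matrix with a single 1 in its first entry. *)
  pose b (j : 'I_n) : R[i] := (val j == 0)%N%:R.
  have b0 j : 0 <= b j by rewrite ler0n.
  have pb := possemidef_udiag 1%:M b0.
  exists (Hermx (proj1 pb)); split => /=; last first.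
    rewrite udiag_rank_le// => j kj; rewrite /b.
    by rewrite gtn_eqF// (leq_trans k0).
  split=> //; rewrite mxtrace_udiag// (bigD1 (Ordinal n0))//= big1 ?addr0//.
  by move=> j; rewrite -(inj_eq val_inj) /b /= => /negPf ->.
move=> X [[Xh Xpos] Xtr].
have [V [s [Vu XE s0 smono]]] := psd_udiag Xh Xpos.
have sv := sv_data_udiag Vu s0 smono; rewrite -XE in sv.
have tE := @tail_to_cmx R (Herm n) X V s k sv.
(* The eigenvectors of [X] are kept and only its spectrum is truncated, preserving the sum and hence
   the trace. *)
have [b [b0 bk sb sqb]] := simplex_truncation k0 n0 s0.
have pb := possemidef_udiag V b0.
exists (Hermx (proj1 pb)).
  split; last by rewrite /= udiag_rank_le.
  by split=> //=; rewrite mxtrace_udiag// sb -(mxtrace_udiag _ Vu) -XE.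
apply: hermx_norm_le; first by rewrite mulr_ge0 ?sqrtr_ge0 ?sigma_tail_ge0.
rewrite -realCX exprMn sqr_sqrtr//.
have -> : (2 * sigma_tail k X ^+ 2)%:C = 2 * tail k s ^+ 2.
  by rewrite tE realCM realCX realCn.
apply: le_trans sqb.
rewrite [hermx_val _](_ : _ = udiag V (fun j => s j - b j)).
  by rewrite fdot_udiag// => j; rewrite realB// ger0_real.
by rewrite -udiagB -XE.
Qed.

Lemma elliptope_error_bound (n k : nat) : (0 < k)%N ->
  let Omega : set (mspace_type R (Herm n)) :=
    [set X : hermx R n | possemidef X /\ forall i, X i i = 1] in
  error_bound Omega k (1 + 2 * n%:R).
Proof.
move=> k0 Omega.
apply: error_bound_of_approx; first by rewrite addr_ge0 ?mulr_ge0 ?ler0n.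
  (* The all-ones matrix is a feasible point of rank at most one. *)
  have p1 := @const_mx1_psd R[i] n.
  exists (Hermx (proj1 p1)); split=> /=; last exact: const_mx1_rank_le.
  by split=> // i; rewrite mxE.
move=> X [[Xh Xpos] Xd].
have [V [s [Vu XE s0 smono]]] := psd_udiag Xh Xpos.
have sv := sv_data_udiag Vu s0 smono; rewrite -XE in sv.
have tE := @tail_to_cmx R (Herm n) X V s k sv.
have Xd' i : udiag V s i i = 1 by rewrite -XE.
have [Z [Y [Zh Yp [rY Y1] XZ ZY]]] := elliptope_truncation k0 Vu s0 Xd'.
pose HZ := Hermx Zh; pose HY := Hermx (proj1 Yp).
exists HY; first by [].
have t0 : 0 <= sigma_tail k X by exact: sigma_tail_ge0.
have h1 : `|X - HZ| <= (1 + n%:R) * sigma_tail k X.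
  apply: hermx_norm_le; first by rewrite mulr_ge0// addr_ge0 ?ler0n.
  by rewrite -[1]/(1%:R : R) -natrD realCM realCn -tE natrD /= XE.
have h2 : `|HZ - HY| <= n%:R * sigma_tail k X.
  apply: hermx_norm_le; first by rewrite mulr_ge0// ler0n.
  by rewrite realCM realCn -tE.
rewrite -[X - HY](subrKA HZ) (le_trans (ler_normD _ _))//.
rewrite (le_trans (lerD h1 h2))// -mulrDl; apply: ler_wpM2r => //.
by rewrite mulr2n mulrDl mul1r addrA.
Qed.

End ErrorBounds.

Theorem theorem2p3 (R : realType) :
  (forall (s : mspace) (Omega : set (mspace_type R s)) (kappa : nat),
      (0 < kappa)%N ->
      convex_set Omega ->
      compact Omega ->
      rank_constrained Omega kappa !=set0 ->
      (forall X, tail_level Omega kappa 0 X ->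
         calm (tail_level Omega kappa) 0 X) ->
      exists c : R, 0 < c /\ error_bound Omega kappa c)
  /\
  (forall (n1 n2 kappa : nat) (N : rectmx R n1 n2 -> R) (gamma cl cu : R),
      (0 < kappa)%N ->
      is_norm N -> 0 < gamma -> 0 < cl -> 0 < cu ->
      (forall X : rectmx R n1 n2, cl * `|X| <= N X <= cu * `|X|) ->
      let Omega : set (mspace_type R (Rect n1 n2)) :=
        [set X | N X <= gamma] in
      error_bound Omega kappa (Num.sqrt (1 + cu ^+ 2 / cl ^+ 2)) /\
      (unitarily_invariant N -> error_bound Omega kappa 1))
  /\
  (forall n kappa : nat,
      (0 < n)%N -> (0 < kappa)%N ->
      let Omega : set (mspace_type R (Herm n)) :=
        [set X : hermx R n | possemidef X /\ \tr X = 1] in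
      error_bound Omega kappa (Num.sqrt 2))
  /\
  (forall n kappa : nat,
      (0 < n)%N -> (0 < kappa)%N ->
      let Omega : set (mspace_type R (Herm n)) :=
        [set X : hermx R n | possemidef X /\ forall i, X i i = 1] in
      error_bound Omega kappa (1 + 2 * n%:R)).
Proof.
split=> [s Omega k _ _ cO F0 hc|]; first exact: calm_error_bound.
split=> [n1 n2 k N gamma cl cu _ hN g0 cl0 cu0 hE|].
  exact: norm_ball_error_bound hE.
split=> n k n0 k0; first exact: unit_trace_error_bound.
exact: elliptope_error_bound.
Qed.
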